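(* Let $\Gamma$ be a metric graph or a tropical curve with a real structure and let $D_1,D_2$ be two linearly equivalent real divisors on $\Gamma$. If $\Gamma'$ is a connected component of $\Gamma(\mathbb R)$, then $\deg(D_1|_{\Gamma'})\equiv\deg(D_2|_{\Gamma'})\pmod 2$, where $\deg(D|_{\Gamma'})=\sum_{p\in\Gamma'}D(p)$.
   Context: A metric graph is a compact connected metric space locally isometric to star-shaped sets $\{te^{2k\pi i/n}:0\le t<r\}\subset\mathbb C$; vertices are points of local valence $\ne2$, edges are the components of the complement of the vertices. A tropical curve is the union of a metric graph and finitely many unbounded edges isometric to $[0,\infty]$, each attached at its point $0$. A real structure is an isometric involution $\iota$; $\overline p=\iota(p)$; $\Gamma(\mathbb R)$ is the set of fixed points of $\iota$. A divisor is a finite formal $\mathbb Z$-combination of points; $\overline D(p)=D(\overline p)$; $D$ is real if $\overline D=D$. A rational function is a continuous $f:\Gamma\to\mathbb R$, piecewise affine with integer slopes and finitely many pieces on each edge; $\Delta(f)(p)$ is the sum of the outgoing slopes of $f$ at $p$; $D_1\sim D_2$ iff $D_2-D_1=\Delta(f)$ for some rational function $f$. *)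

(* Defs.v *)
From Stdlib Require List.
From HB Require Import structures.
From mathcomp Require Import all_boot all_order all_algebra.
From mathcomp Require Import boolp classical_sets functions cardinality fsbigop reals constructive_ereal ereal.
Set Implicit Arguments. Unset Strict Implicit. Unset Printing Implicit Defensive.
Import Order.TTheory GRing.Theory Num.Theory.
Local Open Scope classical_set_scope.
Local Open Scope ring_scope.

(* A tropical curve (a metric graph is the case without legs) is presented   *)
(* by a finite model: a finite connected multigraph (loops allowed) with     *)
(* vertex set V, edge set E, each edge e a segment [0, len e] glued at       *)
(* t = 0 to src e and at t = len e to tgt e, plus finitely many legs         *)
(* (unbounded edges) l, each a copy of [0, +oo] glued at 0 to att l.         *)

Fixpoint walk_ok (V E : Type) (eqV : V -> V -> bool) (src tgt : E -> V)
    (u w : V) (s : seq (E * bool)) : bool :=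
  match s with
  | [::] => eqV u w
  | (e, b) :: s' => eqV (if b then src e else tgt e) u &&
                    walk_ok eqV src tgt (if b then tgt e else src e) w s'
  end.

Record tcurve (R : realType) := TCurve {
  tV : finType;
  tE : finType;
  tL : finType;
  src : tE -> tV;
  tgt : tE -> tV;
  len : tE -> R;
  att : tL -> tV;
  len_gt0 : forall e, 0 < len e;
  tV_nonempty : (0 < #|tV|)%N;
  tconnected : forall u w : tV,
      exists s, walk_ok (fun x y => x == y) src tgt u w s }.

Section TropicalCurve.
Variable R : realType.
Variable G : tcurve R.

Local Notation V := (tV G).
Local Notation E := (tE G).
Local Notation L := (tL G).

(* raw points: a vertex | (e,t) interior point of an edge | (l,t) finite
   interior point of a leg | the point at infinity of a leg *)
Definition rawpt : Type := (V + ((E * R) + ((L * R) + L)))%type.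

Definition pt_valid (x : rawpt) : bool :=
  match x with
  | inl _ => true
  | inr (inl (e, t)) => (0 < t) && (t < len e)
  | inr (inr (inl (_, t))) => 0 < t
  | inr (inr (inr _)) => true
  end.

Definition tpoint : Type := {x : rawpt | pt_valid x}.

Definition vpt (v : V) : tpoint := exist _ (inl v) isT.
Definition infpt (l : L) : tpoint := exist _ (inr (inr (inr l))) isT.

(* the point at distance t from src e along the (closed) edge e, t in [0, len e] *)
Definition edge_pt (e : E) (t : R) : tpoint :=
  match insub (inr (inl (e, t)) : rawpt) with
  | Some p => p
  | None => if t <= 0 then vpt (src e) else vpt (tgt e)
  end.

(* the point at distance t from att l along the leg l, t in [0, +oo) *)
Definition leg_pt (l : L) (t : R) : tpoint :=
  match insub (inr (inr (inl (l, t))) : rawpt) with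
  | Some p => p
  | None => vpt (att l)
  end.

Local Open Scope ereal_scope.

Definition walk_len (s : seq (E * bool)) : R := (\sum_(x <- s) len x.1)%R.

Definition vdist (u w : V) : \bar R :=
  ereal_inf [set (walk_len s)%:E | s in
               [set s | walk_ok (fun x y => x == y) (@src _ G) (@tgt _ G) u w s]].

(* vertices of the model through which a geodesic leaving p may pass,
   with the distance from p to them inside the closed edge containing p *)
Definition anchors (p : tpoint) : seq (V * R) :=
  match val p with
  | inl v => [:: (v, 0%R)]
  | inr (inl (e, t)) => [:: (src e, t); (tgt e, (len e - t)%R)]
  | inr (inr (inl (l, t))) => [:: (att l, t)]
  | inr (inr (inr _)) => [::]
  end.

Definition direct (p q : tpoint) : \bar R :=
  match val p, val q with
  | inr (inl (e, t)), inr (inl (e', t')) =>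
      if e == e' then (`|t - t'|)%:E else +oo
  | inr (inr (inl (l, t))), inr (inr (inl (l', t'))) =>
      if l == l' then (`|t - t'|)%:E else +oo
  | inr (inr (inr l)), inr (inr (inr l')) => if l == l' then 0 else +oo
  | _, _ => +oo
  end.

(* the (extended) path metric of Gamma; points at infinity are at
   distance +oo from every other tpoint *)
Definition pdist (p q : tpoint) : \bar R :=
  mine (direct p q)
    (\big[mine/+oo]_(a <- anchors p) \big[mine/+oo]_(b <- anchors q)
        (a.2%:E + vdist a.1 b.1 + b.2%:E)).

Definition gopen (U : set tpoint) : Prop :=
  forall p, U p ->
    (forall l, p = infpt l ->
       exists T : R, (forall t, (T < t)%R -> U (leg_pt l t)))
    /\ ((forall l, p <> infpt l) ->
       exists2 r : R, (0 < r)%R & [set q | pdist p q < r%:E] `<=` U).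

Definition gcontinuous (f : tpoint -> tpoint) : Prop :=
  forall U, gopen U -> gopen (f @^-1` U).

Definition gconnected (A : set tpoint) : Prop :=
  forall U W, gopen U -> gopen W -> A `<=` U `|` W -> A `&` U `&` W = set0 ->
    A `<=` U \/ A `<=` W.

Definition component_of (A C : set tpoint) : Prop :=
  [/\ C `<=` A, C !=set0, gconnected C &
      forall C', C `<=` C' -> C' `<=` A -> gconnected C' -> C' = C].

Definition real_structure (iota : tpoint -> tpoint) : Prop :=
  [/\ involutive iota,
      (forall p q, pdist (iota p) (iota q) = pdist p q) &
      gcontinuous iota].

Definition real_locus (iota : tpoint -> tpoint) : set tpoint :=
  [set p | iota p = p].

Local Close Scope ereal_scope.

Definition is_divisor (D : tpoint -> int) : Prop :=
  finite_set [set p | D p != 0].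

Definition real_divisor (iota : tpoint -> tpoint) (D : tpoint -> int) : Prop :=
  forall p, D (iota p) = D p.

Definition deg_on (D : tpoint -> int) (C : set tpoint) : int :=
  \sum_(p \in C) D p.

Definition pw_affine_seg (g : R -> R) (b : R) : Prop :=
  exists (n : nat) (a : nat -> R) (m : nat -> int) (c : nat -> R),
    [/\ a 0%N = 0, a n = b,
        (forall i, (i < n)%N -> a i < a i.+1) &
        (forall i t, (i < n)%N -> a i <= t <= a i.+1 -> g t = (m i)%:~R * t + c i)].

(* g is piecewise affine on [0, +oo) with integer slopes, finitely many pieces,
   and continuous at +oo with limit y (the last piece is then constant = y) *)
Definition pw_affine_leg (g : R -> R) (y : R) : Prop :=
  exists (n : nat) (a : nat -> R) (m : nat -> int) (c : nat -> R),
    [/\ a 0%N = 0,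
        (forall i, (i < n)%N -> a i < a i.+1),
        (forall i t, (i < n)%N -> a i <= t <= a i.+1 -> g t = (m i)%:~R * t + c i) &
        (forall t, a n <= t -> g t = y)].

(* A rational function: f : Gamma -> R continuous, piecewise affine with
   integer slopes and finitely many pieces on each edge.  Continuity at
   the vertices is automatic since the edge functions below are built from
   f evaluated at the endpoints. *)
Definition rational_fun (f : tpoint -> R) : Prop :=
  (forall e, pw_affine_seg (fun t => f (edge_pt e t)) (len e)) /\
  (forall l, pw_affine_leg (fun t => f (leg_pt l t)) (f (infpt l))).

(* unit-speed germs of paths leaving p, one for each outgoing direction
   (a loop at v gives two directions at v); a tpoint at infinity has no
   direction along which the slope of a rational function is nonzero,
   since rational functions are constant near it. *)
Definition dirs (p : tpoint) : seq (R -> tpoint) :=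
  match val p with
  | inl v => [seq edge_pt e | e <- enum E & src e == v]
          ++ [seq (fun s => edge_pt e (len e - s)) | e <- enum E & tgt e == v]
          ++ [seq leg_pt l | l <- enum L & att l == v]
  | inr (inl (e, t)) => [:: (fun s => edge_pt e (t + s)); (fun s => edge_pt e (t - s))]
  | inr (inr (inl (l, t))) => [:: (fun s => leg_pt l (t + s)); (fun s => leg_pt l (t - s))]
  | inr (inr (inr _)) => [::]
  end.

Definition out_slope (f : tpoint -> R) (gamma : R -> tpoint) (m : int) : Prop :=
  exists2 eps : R, 0 < eps &
    forall s, 0 <= s <= eps -> f (gamma s) = f (gamma 0) + m%:~R * s.

Definition laplacian_at (f : tpoint -> R) (p : tpoint) (k : int) : Prop :=
  exists ms : seq int,
    List.Forall2 (out_slope f) (dirs p) ms /\ k = \sum_(m <- ms) m.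

Definition lin_equiv (D1 D2 : tpoint -> int) : Prop :=
  exists f, rational_fun f /\ forall p, laplacian_at f p (D2 p - D1 p).

End TropicalCurve.

(* Main.v *)
Require Import Defs.
From HB Require Import structures.
From mathcomp Require Import all_boot all_order all_algebra.
From mathcomp Require Import boolp classical_sets functions cardinality fsbigop reals constructive_ereal ereal.
From mathcomp Require Import topology normedtype derive.
From mathcomp Require Import lra ring.
Import Order.TTheory GRing.Theory Num.Theory.
Import numFieldNormedType.Exports.
Set Implicit Arguments. Unset Strict Implicit. Unset Printing Implicit Defensive.
Local Open Scope classical_set_scope.
Local Open Scope ring_scope.

(* Write D2 - D1 = Delta f.  For small r the metric sphere of radius r about a
   point p consists of one point in each direction at p, so Delta can be read
   off the metric and commutes with iota.  Hence f - f o iota is harmonic, so it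
   is constant by the maximum principle, and since it is odd under iota it
   vanishes: f is iota-invariant.
   At a fixed point p, iota permutes the directions and preserves the slopes of
   f, so Delta f (p) is congruent mod 2 to the sum of the slopes along the fixed
   directions.  A fixed direction at a vertex, and a fixed point interior to an
   edge that is not an isolated fixed point, force the whole edge to be fixed.
   So either C is a single point without fixed directions and the degree is
   even, or C is a union of vertices and entire edges and legs (and possibly
   points at infinity); in the latter case the sum of Delta f over the interior
   of an edge cancels the slopes at its two ends. *)

(** * Real segments *)

Lemma cont_segment (R : realType) (a b : R) (g : R -> R) :
  (forall t, a <= t <= b -> forall e, 0 < e ->
     exists2 d, 0 < d & forall s, a <= s <= b -> `|s - t| < d -> `|g s - g t| < e) ->
  {within `[a, b], continuous g}.
Proof.
move=> H; apply/subspace_continuousP => t; rewrite /= in_itv /= => tab.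
apply/cvgrPdist_lt => e e0; have [d d0 Hd] := H t tab e e0.
apply/nbhs_ballP; exists d => //= s; rewrite /ball /= => ts.
by rewrite in_itv /= => sab; rewrite distrC; apply: Hd => //; rewrite distrC.
Qed.

(** Connectedness of a segment: the indicator of a locally constant predicate is continuous, so by
    the intermediate value theorem it cannot pass from 1 to 0 without taking the value 1/2. *)
Lemma loc_const_segment (R : realType) (a b : R) (A : R -> Prop) :
  (forall t, a <= t <= b -> exists2 d, 0 < d &
     forall s, a <= s <= b -> `|s - t| < d -> (A s <-> A t)) ->
  forall x y, a <= x <= b -> a <= y <= b -> A x -> A y.
Proof.
move=> H x y xab yab Ax; apply: contrapT => nAy.
have aleb : a <= b by case/andP: xab => ax; exact: le_trans.
pose g t : R := if asbool (A t) then 1 else 0.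
(* The case [y <= x] reduces to this one by passing to the complement of [A] and exchanging the two
   points. *)
wlog : a b A H x y xab yab Ax nAy aleb @g / x <= y.
  move=> W; have [xy|/ltW yx] := leP x y; first by apply: (W a b A H x y).
  apply: (W a b (fun t => ~ A t) _ y x) => //.
  move=> t tab; have [d d0 Hd] := H t tab; exists d => // s sab st.
  by rewrite (propext (Hd s sab st)).
move=> xy.
have cg : {within `[x, y], continuous g}.
  apply: cont_segment => t txy e e0.
  have [|d d0 Hd] := H t; first lra.
  exists d => // s sxy st; rewrite /g.
  have /propext -> := Hd s ltac:(lra) st.
  by rewrite subrr normr0.
have [|c _] := @IVT R g x y (2^-1) xy cg.
  rewrite /g (asboolT Ax) (asboolF nAy) ge_min le_max; lra.
rewrite /g; case: ifP => _; lra.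
Qed.

(** * Distances and spheres *)

Section Distance.
Variables (R : realType) (G : tcurve R).
Implicit Types (p q : tpoint G) (v w : tV G) (e : tE G) (l : tL G) (t r : R).

Lemma edge_pt_val e t : 0 < t < len e -> val (edge_pt e t) = inr (inl (e, t)).
Proof. by move=> te; rewrite /edge_pt insubT. Qed.

Lemma edge_pt_src e t : t <= 0 -> edge_pt e t = vpt (src e).
Proof. by move=> t0; rewrite /edge_pt insubN /= ?t0 // ltNge t0. Qed.

Lemma edge_pt_tgt e t : len e <= t -> edge_pt e t = vpt (tgt e).
Proof.
move=> t0; have e0 := len_gt0 e; rewrite /edge_pt insubN /= ?[t < _]ltNge ?t0 ?andbF //.
by rewrite leNgt (lt_le_trans e0).
Qed.

Lemma leg_pt_val l t : 0 < t -> val (leg_pt l t) = inr (inr (inl (l, t))).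
Proof. by move=> te; rewrite /leg_pt insubT. Qed.

Lemma leg_pt0 l t : t <= 0 -> leg_pt l t = vpt (att l).
Proof. by move=> t0; rewrite /leg_pt insubN //= ltNge t0. Qed.

(** Case analysis in terms of the parametrisations, so that no validity proof of the subset type has
    to be handled later. *)
Variant pt_spec : tpoint G -> Prop :=
| PtVertex v : pt_spec (vpt v)
| PtEdge e t of 0 < t < len e : pt_spec (edge_pt e t)
| PtLeg l t of 0 < t : pt_spec (leg_pt l t)
| PtInf l : pt_spec (infpt l).

Lemma ptP p : pt_spec p.
Proof.
case: p => [[v|[[e t]|[[l t]|l]]]] Hp.
- rewrite (_ : exist _ _ _ = vpt v); [exact: PtVertex|exact: val_inj].
- rewrite (_ : exist _ _ _ = edge_pt e t); [exact: PtEdge|].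
  by apply: val_inj; rewrite edge_pt_val.
- rewrite (_ : exist _ _ _ = leg_pt l t); [exact: PtLeg|].
  by apply: val_inj; rewrite leg_pt_val.
- rewrite (_ : exist _ _ _ = infpt l); [exact: PtInf|exact: val_inj].
Qed.

Definition finpt p : bool := if val p is inr (inr (inr _)) then false else true.

Lemma finpt_edge e t : finpt (edge_pt e t).
Proof.
have [te|] := boolP (0 < t < len e); first by rewrite /finpt edge_pt_val.
by rewrite negb_and -!leNgt => /orP[/edge_pt_src|/edge_pt_tgt] ->.
Qed.

Lemma finpt_leg l t : finpt (leg_pt l t).
Proof. by have [/leg_pt0 ->|t0] := leP t 0; rewrite /finpt // leg_pt_val. Qed.

Lemma walk_len_ge0 (s : seq (tE G * bool)) : 0 <= walk_len s.
Proof. by apply: sumr_ge0 => x _; exact/ltW/len_gt0. Qed.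

Local Open Scope ereal_scope.

Lemma vdist_ge0 v w : 0 <= vdist v w.
Proof. by apply: le_ereal_inf_tmp => _ [s _ <-]; rewrite lee_fin walk_len_ge0. Qed.

Lemma vdist_vv v : vdist v v = 0.
Proof.
apply/eqP; rewrite eq_le vdist_ge0 andbT; apply: ereal_inf_lbound.
by exists [::]; rewrite /= ?eqxx // /walk_len big_nil.
Qed.

Lemma vdist_lty v w : vdist v w < +oo.
Proof.
have [s Hs] := tconnected v w.
apply: (@le_lt_trans _ _ (walk_len s)%:E); last by rewrite ltry.
by apply: ereal_inf_lbound; exists s.
Qed.

Lemma bigmin_attained (I : eqType) (s : seq I) (F : I -> \bar R) :
  let B := \big[mine/+oo]_(a <- s) F a in B = +oo \/ exists2 a, a \in s & B = F a.
Proof.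
elim: s => [|a s IH] /=; first by left; rewrite big_nil.
rewrite big_cons /mine; case: ifP => _; first by right; exists a; rewrite ?mem_head.
by case: IH => [->|[b bs ->]]; [left|right; exists b; rewrite ?inE ?bs ?orbT].
Qed.

Definition vd v w : R := fine (vdist v w).

Lemma vdE v w : vdist v w = (vd v w)%:E.
Proof. by rewrite /vd fineK // ge0_fin_numE ?vdist_ge0 ?vdist_lty. Qed.

Local Close Scope ereal_scope.

Lemma vd_ge0 v w : 0 <= vd v w.
Proof. by rewrite -lee_fin -vdE vdist_ge0. Qed.

Lemma vd_vv v : vd v v = 0.
Proof. by rewrite /vd vdist_vv. Qed.

(** A walk between distinct vertices traverses at least one edge, so the shortest edge length also
    bounds vertex distances from below. *)
Lemma min_edge : exists2 m : R, 0 < m &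
  (forall e, m <= len e) /\ forall v w, v != w -> m <= vd v w.
Proof.
(* The default value 1 keeps the minimum positive when there are no edges. *)
pose m := \big[Num.min/1]_(e : tE G) len e.
have mle e : m <= len e by rewrite /m; apply: bigmin_le_cond.
exists m; first by apply/bigmin_gtP; split => // e _; exact: len_gt0.
split => // v w vw; rewrite -lee_fin -vdE.
apply: le_ereal_inf_tmp => _ [[|[e b] s] /= Hs <-]; first by rewrite Hs in vw.
rewrite lee_fin /walk_len big_cons /=.
by apply: (le_trans (mle e)); rewrite lerDl walk_len_ge0.
Qed.

(** Length of a route between two points that leaves the first through its anchor [a] and reaches
    the second through its anchor [b]. *)
Definition via (a b : tV G * R) : R := a.2 + vd a.1 b.1 + b.2.

Lemma pdistE p q : pdist p q = mine (direct p q)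
  (\big[mine/+oo%E]_(a <- anchors p) \big[mine/+oo%E]_(b <- anchors q) (via a b)%:E).
Proof.
rewrite /pdist; congr mine; apply: eq_bigr => a _; apply: eq_bigr => b _.
by rewrite vdE.
Qed.

Lemma pdist_cases p q : pdist p q = direct p q \/
  exists a b, [/\ a \in anchors p, b \in anchors q & pdist p q = (via a b)%:E].
Proof.
rewrite pdistE; set B := \big[mine/+oo%E]_(a <- _) _.
case: (leP (direct p q) B) => [le|lt]; first by left.
have [Boo|[a pa Ba]] := bigmin_attained (anchors p)
  (fun a => \big[mine/+oo%E]_(b <- anchors q) (via a b)%:E).
  by move: lt; rewrite /B Boo ltNge leey.
have [Boo|[b qb Bb]] := bigmin_attained (anchors q) (fun b => (via a b)%:E).
  by move: lt; rewrite /B Ba Boo ltNge leey.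
by right; exists a, b; split => //; rewrite /B Ba Bb.
Qed.

Lemma pdist_le_direct p q : (pdist p q <= direct p q)%E.
Proof. by rewrite /pdist ge_min lexx. Qed.

Lemma pdist_le_via p q a b :
  a \in anchors p -> b \in anchors q -> (pdist p q <= (via a b)%:E)%E.
Proof.
move=> pa qb; rewrite pdistE ge_min; apply/orP; right.
apply: bigmin_inf_seq pa _ _ => //.
exact: bigmin_inf_seq qb _ _.
Qed.

(** The distance is a minimum over finitely many routes, so a lower bound that one route attains is
    its value. *)
Lemma pdist_eq p q r :
  (r%:E <= direct p q)%E ->
  (forall a b, a \in anchors p -> b \in anchors q -> r <= via a b) ->
  direct p q = r%:E \/
    (exists a b, [/\ a \in anchors p, b \in anchors q & via a b = r]) ->
  pdist p q = r%:E.
Proof.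
move=> rd rv H; apply/eqP; rewrite eq_le; apply/andP; split.
  case: H => [<-|[a [b [pa qb <-]]]]; first exact: pdist_le_direct.
  exact: pdist_le_via.
by case: (pdist_cases p q) => [->//|[a [b [pa qb ->]]]]; rewrite lee_fin rv.
Qed.

Lemma anchorsP p a : a \in anchors p -> 0 <= a.2 /\ (a.2 = 0 -> p = vpt a.1).
Proof.
case: (ptP p) => [v|e t te|l t t0|l]; rewrite /anchors ?edge_pt_val ?leg_pt_val //=.
- by rewrite inE => /eqP -> /=; split.
- by rewrite !inE => /orP[] /eqP -> /=; (split; [lra|move=> ?; exfalso; lra]).
- by rewrite !inE => /eqP -> /=; (split; [lra|move=> ?; exfalso; lra]).
Qed.

Lemma pdist_vpt_via v q r : pdist (vpt v) q = r%:E ->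
  exists2 b, b \in anchors q & r = vd v b.1 + b.2.
Proof.
case: (pdist_cases (vpt v) q) => [->|]; first by rewrite /direct /=; case: (val q).
move=> [a [b [+ qb ->]]]; rewrite inE => /eqP -> [<-]; exists b => //.
by rewrite /via /= add0r.
Qed.

(** As [r] is at most the distance to either end, a route that leaves the edge has length at least
    [r], with equality only if it stops at that end. The description is therefore exact for large
    radii too, on which the propagation of fixed points along arcs relies. *)
Lemma pdist_edge e t r q : 0 < t < len e -> 0 < r -> r <= t -> r <= len e - t ->
  pdist (edge_pt e t) q = r%:E <-> q = edge_pt e (t - r) \/ q = edge_pt e (t + r).
Proof.
move=> te r0 rt rlt; split.
  case: (pdist_cases (edge_pt e t) q) => [|[a [b [pa qb]]]] ->.
    rewrite /direct edge_pt_val //.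
    case: (ptP q) => [v|e' t' te'|l' t' t0'|l] //=; rewrite ?edge_pt_val ?leg_pt_val //.
    case: eqP => [ee'|//]; subst e' => -[]; case: (leP t' t) => tt' rtt'; [left|right];
      congr edge_pt; move: rtt'; [rewrite ger0_norm|rewrite ltr0_norm]; lra.
  have [b0 Hb] := anchorsP qb; have v0 := vd_ge0 a.1 b.1; rewrite /via => -[Er].
  (* The offset to the anchor already uses up the whole length [r], so [q] must be the anchor
     itself. *)
  have a2 : a.2 = r /\ vd a.1 b.1 = 0 /\ b.2 = 0.
    move: pa; rewrite /anchors edge_pt_val //= !inE.
    by case/orP => /eqP Ea; move: Er v0; rewrite Ea /=; lra.
  case: a2 => a2 [va b20].
  have -> : q = vpt a.1.
    rewrite Hb //; case: (eqVneq a.1 b.1) => [->//|ab].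
    by have [m m0 [_ Hd]] := min_edge; exfalso; have := Hd _ _ ab; lra.
  move: pa a2; rewrite /anchors edge_pt_val //= !inE => /orP[] /eqP -> /= Etr; [left|right].
    by rewrite edge_pt_src //; lra.
  by rewrite edge_pt_tgt //; lra.
move=> Hq; have qe : exists2 t', q = edge_pt e t' & (0 <= t' <= len e) /\ `|t - t'| = r.
  case: Hq => ->; eexists; try reflexivity; split; try lra.
    by rewrite ger0_norm; lra.
  by rewrite ler0_norm; lra.
case: qe => t' -> {q Hq} [t'e tt'].
have Hv a b : a \in anchors (edge_pt e t) -> b \in anchors (edge_pt e t') -> r <= via a b.
  move=> pa qb; have [b0 _] := anchorsP qb; have v0 := vd_ge0 a.1 b.1; rewrite /via.
  move: pa; rewrite /anchors edge_pt_val //= !inE.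
  by case/orP => /eqP Ea; move: v0; rewrite Ea /=; lra.
have [t'in|] := boolP (0 < t' < len e).
  have E : direct (edge_pt e t) (edge_pt e t') = r%:E.
    by rewrite /direct !edge_pt_val //= eqxx tt'.
  by apply: pdist_eq => //; [rewrite E|left].
rewrite negb_and -!leNgt => t'out; apply: pdist_eq => //.
  by case/orP: t'out => [/edge_pt_src|/edge_pt_tgt] ->; rewrite /direct edge_pt_val //= leey.
right; case/orP: t'out => Ht'.
  exists (src e, t), (src e, 0); rewrite (edge_pt_src _ Ht') /anchors edge_pt_val //=.
  rewrite !inE !eqxx; split => //.
  rewrite /via /= vd_vv; move: tt'; rewrite ger0_norm; lra.
exists (tgt e, len e - t), (tgt e, 0); rewrite (edge_pt_tgt Ht') /anchors edge_pt_val //=.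
rewrite !inE !eqxx ?orbT; split => //.
rewrite /via /= vd_vv; move: tt'; rewrite ler0_norm; lra.
Qed.

Lemma pdist_leg l t r q : 0 < r -> r <= t ->
  pdist (leg_pt l t) q = r%:E <-> q = leg_pt l (t - r) \/ q = leg_pt l (t + r).
Proof.
move=> r0 rt; have t0 : 0 < t by exact: lt_le_trans rt.
split.
  case: (pdist_cases (leg_pt l t) q) => [|[a [b [pa qb]]]] ->.
    rewrite /direct leg_pt_val //.
    case: (ptP q) => [v|e' t' te'|l' t' t0'|l'] //=; rewrite ?edge_pt_val ?leg_pt_val //.
    case: eqP => [ll'|//]; subst l' => -[]; case: (leP t' t) => tt' rtt'; [left|right];
      congr leg_pt; move: rtt'; [rewrite ger0_norm|rewrite ltr0_norm]; lra.
  have [b0 Hb] := anchorsP qb; have v0 := vd_ge0 a.1 b.1; rewrite /via => -[Er].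
  have a2 : t = r /\ vd a.1 b.1 = 0 /\ b.2 = 0.
    by move: pa; rewrite /anchors leg_pt_val //= !inE => /eqP Ea; move: Er v0; rewrite Ea /=; lra.
  case: a2 => a2 [va b20]; left.
  have -> : q = vpt a.1.
    rewrite Hb //; case: (eqVneq a.1 b.1) => [->//|ab].
    by have [m m0 [_ Hd]] := min_edge; exfalso; have := Hd _ _ ab; lra.
  by move: pa; rewrite /anchors leg_pt_val //= !inE => /eqP -> /=; rewrite leg_pt0 //; lra.
move=> Hq; have qe : exists2 t', q = leg_pt l t' & 0 <= t' /\ `|t - t'| = r.
  case: Hq => ->; eexists; try reflexivity; split; try lra.
    by rewrite ger0_norm; lra.
  by rewrite ler0_norm; lra.
case: qe => t' -> {q Hq} [t'e tt'].
have Hv a b : a \in anchors (leg_pt l t) -> b \in anchors (leg_pt l t') -> r <= via a b.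
  move=> pa qb; have [b0 _] := anchorsP qb; have v0 := vd_ge0 a.1 b.1; rewrite /via.
  by move: pa; rewrite /anchors leg_pt_val //= !inE => /eqP Ea; move: v0; rewrite Ea /=; lra.
have [t'0|t'in] := leP t' 0.
  apply: pdist_eq => //; first by rewrite (leg_pt0 _ t'0) /direct leg_pt_val //= leey.
  right; exists (att l, t), (att l, 0); rewrite (leg_pt0 _ t'0) /anchors leg_pt_val //= !inE !eqxx.
  split => //; rewrite /via /= vd_vv; move: tt'; rewrite ger0_norm; lra.
have E : direct (leg_pt l t) (leg_pt l t') = r%:E.
  by rewrite /direct !leg_pt_val //= eqxx tt'.
by apply: pdist_eq => //; [rewrite E|left].
Qed.

(** Indexed by directions, so that sums over directions at [p] become sums over this list. It is the
    metric sphere only for small [r]. *)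
Definition sphere p r : seq (tpoint G) := [seq g r | g <- dirs p].

Lemma sphere_vpt v r : sphere (vpt v) r =
  [seq edge_pt e r | e <- enum (tE G) & src e == v] ++
  [seq edge_pt e (len e - r) | e <- enum (tE G) & tgt e == v] ++
  [seq leg_pt l r | l <- enum (tL G) & att l == v].
Proof. by rewrite /sphere /dirs /= !map_cat -!map_comp. Qed.

Lemma pdist_vpt_edge_src m v e r : (forall e, m <= len e) -> (forall v w, v != w -> m <= vd v w) ->
  0 < r -> r < m / 2 -> src e = v -> pdist (vpt v) (edge_pt e r) = r%:E.
Proof.
move=> Hl Hd r0 rm <-; have le := Hl e; have re : 0 < r < len e by lra.
apply: pdist_eq; first by rewrite /direct edge_pt_val //= leey.
  move=> a b; rewrite /anchors edge_pt_val //= inE => /eqP ->; rewrite /via /=.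
  have v0 := vd_ge0 (src e) b.1.
  by rewrite !inE => /orP[] /eqP Eb; move: v0; rewrite Eb /=; lra.
right; exists (src e, 0), (src e, r); rewrite /anchors edge_pt_val //= !inE !eqxx.
by split => //; rewrite /via /= vd_vv; lra.
Qed.

Lemma pdist_vpt_edge_tgt m v e r : (forall e, m <= len e) -> (forall v w, v != w -> m <= vd v w) ->
  0 < r -> r < m / 2 -> tgt e = v -> pdist (vpt v) (edge_pt e (len e - r)) = r%:E.
Proof.
move=> Hl Hd r0 rm <-; have le := Hl e; have re : 0 < len e - r < len e by lra.
apply: pdist_eq; first by rewrite /direct edge_pt_val //= leey.
  move=> a b; rewrite /anchors edge_pt_val //= inE => /eqP ->; rewrite /via /=.
  have v0 := vd_ge0 (tgt e) b.1.
  by rewrite !inE => /orP[] /eqP Eb; move: v0; rewrite Eb /=; lra.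
right; exists (tgt e, 0), (tgt e, r); rewrite /anchors edge_pt_val //= !inE.
split => //; last by rewrite /via /= vd_vv; lra.
by apply/orP; right; apply/eqP; congr (_, _); lra.
Qed.

Lemma pdist_vpt_leg v l r : 0 < r -> att l = v -> pdist (vpt v) (leg_pt l r) = r%:E.
Proof.
move=> r0 <-.
apply: pdist_eq; first by rewrite /direct leg_pt_val //= leey.
  move=> a b; rewrite /anchors leg_pt_val //= !inE => /eqP -> /eqP ->; rewrite /via /=.
  have v0 := vd_ge0 (att l) (att l); lra.
right; exists (att l, 0), (att l, r); rewrite /anchors leg_pt_val //= !inE !eqxx.
by split => //; rewrite /via /= vd_vv; lra.
Qed.

Lemma sphere_vptP : exists2 m : R, 0 < m & (forall e, m < len e) /\
  forall v r, 0 < r < m -> uniq (sphere (vpt v) r) /\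
    forall q, pdist (vpt v) q = r%:E <-> q \in sphere (vpt v) r.
Proof.
(* Below half the shortest edge length the two germs of a loop reach distinct points, and a route
   through the far end of an edge is not shorter. *)
have [m m0 [Hl Hd]] := min_edge; exists (m / 2); first by lra.
split=> [e|v r /andP[r0 rm]]; first by have := Hl e; lra.
have re e : 0 < r < len e by have := Hl e; lra.
have re' e : 0 < len e - r < len e by have := Hl e; lra.
have inj1 : injective (fun e => edge_pt e r).
  by move=> e e' /(congr1 val); rewrite !edge_pt_val // => -[].
have inj2 : injective (fun e => edge_pt e (len e - r)).
  by move=> e e' /(congr1 val); rewrite !edge_pt_val // => -[].
have inj3 : injective (fun l => leg_pt l r).
  by move=> e e' /(congr1 val); rewrite !leg_pt_val // => -[].
split.
  rewrite sphere_vpt !cat_uniq !map_inj_uniq ?(filter_uniq _ (enum_uniq _)) //=.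
  apply/andP; split.
    apply/hasPn => p; rewrite mem_cat => /orP[] /mapP[x _ ->]; apply/mapP => -[y _].
      move/(congr1 val); rewrite !edge_pt_val // => -[_].
      by have := Hl x; lra.
    by move/(congr1 val); rewrite edge_pt_val // leg_pt_val.
  rewrite andbT; apply/hasPn => p /mapP[x _ ->]; apply/mapP => -[y _].
  by move/(congr1 val); rewrite edge_pt_val // leg_pt_val.
move=> q; rewrite sphere_vpt !mem_cat; split.
  move=> /pdist_vpt_via[b qb Er].
  have [b0 _] := anchorsP qb.
  (* The radius is too small for a shortest route from [v] to pass through another vertex. *)
  have vb : v = b.1 by apply/eqP/negPn/negP => vb; have := Hd _ _ vb; lra.
  rewrite -vb vd_vv add0r in Er.
  move: vb Er qb; case: b {b0} => [w b] /= <- <- {w b}.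
  case: (ptP q) => [w|e t te|l t t0|l]; rewrite /anchors ?edge_pt_val ?leg_pt_val //= ?inE => H.
  - by move: H => /eqP[_ rr0]; rewrite rr0 ltxx in r0.
  - case/orP: H => /eqP[vE rE].
      by rewrite rE; apply/orP; left; apply: map_f; rewrite mem_filter mem_enum vE eqxx.
    apply/orP; right; apply/orP; left; apply/mapP; exists e.
      by rewrite mem_filter mem_enum vE eqxx.
    by congr edge_pt; lra.
  - case/eqP: H => vE ->; apply/orP; right; apply/orP; right.
    by apply: map_f; rewrite mem_filter mem_enum vE eqxx.
case/or3P => /mapP[x]; rewrite mem_filter => /andP[/eqP vE _] ->.
- exact: (pdist_vpt_edge_src Hl Hd).
- exact: (pdist_vpt_edge_tgt Hl Hd).
- exact: pdist_vpt_leg.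
Qed.

(** This makes the directions visible to the metric: an isometry has to permute the points of small
    spheres, hence the directions. *)
Lemma sphereP p : finpt p -> exists2 m : R, 0 < m & forall r, 0 < r < m ->
  uniq (sphere p r) /\ forall q, pdist p q = r%:E <-> q \in sphere p r.
Proof.
have [m m0 [_ Hm]] := sphere_vptP.
case: (ptP p) => [v|e t te|l t t0|l] // _.
- by exists m => // r; exact: Hm.
- exists (Num.min t (len e - t)); first by rewrite lt_min; lra.
  move=> r; rewrite lt_min => /and3P[r0 rt rl].
  rewrite /sphere /dirs edge_pt_val //=; split.
    rewrite inE andbT; apply/eqP => /(congr1 val); rewrite !edge_pt_val; [|lra|lra].
    by case; lra.
  move=> q; rewrite pdist_edge; [|lra..].
  by rewrite !inE; split => [[]->|/orP[]/eqP ->]; rewrite ?eqxx ?orbT; auto.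
- exists t => // r /andP[r0 rt].
  rewrite /sphere /dirs leg_pt_val //=; split.
    rewrite inE andbT; apply/eqP => /(congr1 val); rewrite !leg_pt_val; [|lra|lra].
    by case; lra.
  move=> q; rewrite pdist_leg; [|lra..].
  by rewrite !inE; split => [[]->|/orP[]/eqP ->]; rewrite ?eqxx ?orbT; auto.
Qed.

(* A parametrised segment of length b whose interior is locally a line.  It need
   not be embedded: g 0 = g b when g runs along a loop. *)
Record arc (g : R -> tpoint G) (b : R) : Prop := Arc {
  arc_gt0 : 0 < b;
  arc_sphere : forall t r q, 0 < t < b -> 0 < r -> r <= t -> r <= b - t ->
    pdist (g t) q = r%:E <-> q = g (t - r) \/ q = g (t + r);
  arc_inj : forall x y, 0 <= x <= b -> 0 < y < b -> g x = g y -> x = y;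
  arc_fin : forall t, finpt (g t);
  arc_start : exists2 m : R, 0 < m & forall s, 0 < s < m -> g s \in sphere (g 0) s;
  arc_end : exists2 m : R, 0 < m & forall s, 0 < s < m -> g (b - s) \in sphere (g b) s }.

Lemma arc_edge e : arc (edge_pt e) (len e).
Proof.
have e0 := len_gt0 e; have [m m0 [Hm Hs]] := sphere_vptP.
constructor=> //.
- exact: pdist_edge.
- move=> x y xe ye /(congr1 val); rewrite (edge_pt_val ye).
  have [xi|] := boolP (0 < x < len e); first by rewrite edge_pt_val // => -[].
  by rewrite negb_and -!leNgt => /orP[/edge_pt_src|/edge_pt_tgt] ->.
- exact: finpt_edge.
- exists m => // s sm; rewrite (edge_pt_src e (lexx 0)) sphere_vpt !mem_cat.
  by apply/orP; left; apply: map_f; rewrite mem_filter eqxx mem_enum.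
- exists m => // s sm; rewrite [edge_pt e (len e)]edge_pt_tgt // sphere_vpt !mem_cat.
  apply/orP; right; apply/orP; left; apply/mapP; exists e => //.
  by rewrite mem_filter eqxx mem_enum.
Qed.

(** The far end is an interior point of the leg; [arc_end] is witnessed by its direction back
    towards the vertex. *)
Lemma arc_leg l T : 0 < T -> arc (leg_pt l) T.
Proof.
move=> T0; constructor=> //.
- by move=> t r q t0 r0 rt _; exact: pdist_leg.
- move=> x y xe /andP[y0 yT] /(congr1 val); rewrite (leg_pt_val _ y0).
  by have [/(leg_pt0 l) ->//|x0] := leP x 0; rewrite leg_pt_val // => -[].
- exact: finpt_leg.
- exists 1 => // s sm; rewrite (leg_pt0 l (lexx 0)) sphere_vpt !mem_cat.
  apply/orP; right; apply/orP; right; apply/mapP; exists l => //.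
  by rewrite mem_filter eqxx mem_enum.
- exists T => // s sm; rewrite /sphere /dirs leg_pt_val //=.
  by rewrite !inE eqxx orbT.
Qed.

(** Lets statements about the start of an arc serve the target end of an edge. *)
Lemma arc_rev g b : arc g b -> arc (fun t => g (b - t)) b.
Proof.
case=> b0 Hs Hi Hf H0 H1; constructor=> //.
- move=> t r q tb r0 rt rl; rewrite Hs; [|lra..].
  rewrite (_ : b - t - r = b - (t + r)); [|lra].
  rewrite (_ : b - t + r = b - (t - r)); [|lra].
  by split; case; auto.
- by move=> x y xb yb /Hi H; have := H ltac:(lra) ltac:(lra); lra.
- by rewrite subr0.
- case: H0 => m m0 H; exists m => // s sm; rewrite subrr (_ : b - (b - s) = s); last by lra.
  exact: H.
Qed.

End Distance.

(** * The Laplacian on small spheres *)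

Section Local.
Variables (R : realType) (G : tcurve R).
Implicit Types (p q : tpoint G) (v w : tV G) (e : tE G) (l : tL G) (t r : R).

Lemma pdist_infpt l q r : pdist (infpt l) q = r%:E -> q = infpt l.
Proof.
case: (pdist_cases (infpt l) q) => [->|[a [b []]] //].
case: (ptP q) => [v|e t te|l' t t0|l']; rewrite /direct /= ?edge_pt_val ?leg_pt_val //=.
by case: eqP => // ->.
Qed.

Lemma pdist_finite p q : finpt p -> finpt q -> exists r, pdist p q = r%:E.
Proof.
move=> fp fq.
have anch p' : finpt p' -> exists a, a \in anchors p'.
  case: (ptP p') => [v|e t te|l t t0|l] // _; rewrite /anchors ?edge_pt_val ?leg_pt_val //=;
  by eexists; apply: mem_head.
have [a pa] := anch _ fp; have [b qb] := anch _ fq.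
case: (pdist_cases p q) => [E|[a' [b' [_ _ ->]]]]; last by exists (via a' b').
have := pdist_le_via pa qb; rewrite E /direct.
case: (val p) => [?|[[e t]|[[l t]|l]]]; case: (val q) => [?|[[e' t']|[[l' t']|l']]] //=;
  rewrite ?leye_eq //; case: ifP => // _ _; first [by exists 0 | by exists `|t - t'|].
Qed.

(** Lets the description of spheres be applied to balls. Distance zero forces equality because
    distinct vertices are a positive distance apart. *)
Lemma pdist_ball p q r : (pdist p q < r%:E)%E ->
  q = p \/ exists2 s, 0 < s < r & pdist p q = s%:E.
Proof.
case: (pdist_cases p q) => [E|[a [b [pa qb E]]]].
  move: E; rewrite /direct.
  case Ep: (val p) => [?|[[e t]|[[l t]|l]]]; case Eq: (val q) => [?|[[e' t']|[[l' t']|l']]] //= ->;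
    rewrite ?ltNge ?leey //=; case: eqP => [?|_]; rewrite ?ltNge ?leey //=; subst; rewrite -ltNge.
  - rewrite lte_fin => tr; case: (eqVneq t t') => [tt'|tt']; last first.
      by right; exists `|t - t'| => //; rewrite normr_gt0 subr_eq0 tt'.
    by left; apply: val_inj; rewrite Ep Eq tt'.
  - rewrite lte_fin => tr; case: (eqVneq t t') => [tt'|tt']; last first.
      by right; exists `|t - t'| => //; rewrite normr_gt0 subr_eq0 tt'.
    by left; apply: val_inj; rewrite Ep Eq tt'.
  - by move=> _; left; apply: val_inj; rewrite Ep Eq.
rewrite E lte_fin /via => Hr.
have [a0 Ha] := anchorsP pa; have [b0 Hb] := anchorsP qb; have v0 := vd_ge0 a.1 b.1.
case: (ltP 0 (a.2 + vd a.1 b.1 + b.2)) => H.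
  by right; exists (a.2 + vd a.1 b.1 + b.2) => //; rewrite H Hr.
have [a20 [vd0 b20]] : a.2 = 0 /\ vd a.1 b.1 = 0 /\ b.2 = 0 by lra.
left; rewrite (Ha a20) (Hb b20); congr vpt; apply/eqP/negPn/negP; rewrite eq_sym => ab.
by have [m m0 [_ Hd]] := min_edge G; have := Hd _ _ ab; lra.
Qed.

(** Turns estimates on small spheres into estimates in the parameter of an arc, uniformly for
    interior points and both ends. *)
Lemma arc_local g b t : arc (G := G) g b -> 0 <= t <= b -> exists2 m : R, 0 < m &
  forall s, 0 <= s <= b -> 0 < `|s - t| < m -> g s \in sphere (g t) `|s - t|.
Proof.
move=> Ha tb; have b0 := arc_gt0 Ha.
have [->|t0] := eqVneq t 0.
  have [m m0 H] := arc_start Ha; exists m => // s /andP[s0 _].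
  by rewrite subr0 ger0_norm // => sm; exact: H.
have [->|tb'] := eqVneq t b.
  have [m m0 H] := arc_end Ha; exists m => // s sb.
  rewrite distrC ger0_norm; last lra.
  by move=> sm; have := H _ sm; rewrite (_ : b - (b - s) = s) //; lra.
have ti : 0 < t < b by rewrite !lt_neqAle eq_sym t0 tb'.
have [m m0 Hm] := sphereP (arc_fin Ha t).
exists (Num.min m (Num.min t (b - t))); first by rewrite !lt_min; lra.
move=> s sb /andP[s0]; rewrite !lt_min => /and3P[sm s1 s2].
have [_ Hs] := Hm `|s - t| ltac:(by rewrite s0 sm).
apply/Hs; rewrite (arc_sphere Ha); [|lra..].
case: (leP t s) => ts; [right|left].
  by rewrite ger0_norm; [congr g|]; lra.
by rewrite ltr0_norm; [congr g|]; lra.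
Qed.

Variables (f : tpoint G -> R) (D : tpoint G -> int).

Lemma sphere0 p : all (pred1 p) (sphere p 0).
Proof.
apply/allP => q; case: (ptP p) => [v|e t te|l t t0|l].
- rewrite sphere_vpt !mem_cat => /or3P[] /mapP[x]; rewrite mem_filter => /andP[/eqP <- _] ->.
  + by rewrite edge_pt_src /=.
  + by rewrite subr0 edge_pt_tgt /=.
  + by rewrite leg_pt0 /=.
- by rewrite /sphere /dirs edge_pt_val //= addr0 subr0 !inE orbb.
- by rewrite /sphere /dirs leg_pt_val //= addr0 subr0 !inE orbb.
- by [].
Qed.

(** The radius is the minimum of the finitely many germ radii, and [K] is the sum of the absolute
    values of the slopes. *)
Lemma out_slopes_local (ds : seq (R -> tpoint G)) (ms : seq int) p :
  List.Forall2 (out_slope f) ds ms -> all (pred1 p) [seq g 0 | g <- ds] ->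
  exists2 m : R, 0 < m & exists K : int, 0 <= K /\ forall r, 0 <= r <= m ->
    \sum_(q <- [seq g r | g <- ds]) (f q - f p) = (\sum_(k <- ms) k)%:~R * r /\
    (forall q, q \in [seq g r | g <- ds] ->
       exists2 k : int, f q - f p = k%:~R * r & `|k| <= K).
Proof.
elim => [|g k ds' ms' [eps eps0 Hg] _ IH] /=.
  by move=> _; exists 1 => //; exists 0; split=> // r _; rewrite !big_nil mul0r; split.
case/andP=> /eqP g0 /IH[m m0 [K [K0 H]]].
exists (Num.min m eps); first by rewrite lt_min m0.
exists (K + `|k|); split; first by rewrite addr_ge0.
move=> r; rewrite le_min => /and3P[r0 rm re].
have [|H1 H2] := H r; first by rewrite r0.
have E : f (g r) - f p = k%:~R * r.
  by rewrite Hg ?r0 // g0 addrC addKr.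
split; first by rewrite !big_cons H1 E intrD mulrDl.
move=> q; rewrite inE => /orP[/eqP ->|/H2[k' E' kK]]; first by exists k => //; rewrite lerDr.
by exists k' => //; apply: (le_trans kK); rewrite lerDl.
Qed.

Hypothesis lapf : forall p, laplacian_at f p (D p).

(** Reads the Laplacian off a small sphere, without mention of directions. The bound by [K * r]
    later supplies continuity along arcs. *)
Lemma lap_sphere p : exists2 m : R, 0 < m & exists2 K : R, 0 <= K &
  forall r, 0 < r < m ->
  \sum_(q <- sphere p r) (f q - f p) = (D p)%:~R * r /\
  (forall q, q \in sphere p r ->
     (exists k : int, f q - f p = k%:~R * r) /\ `|f q - f p| <= K * r).
Proof.
have [ms [Hms ->]] := lapf p.
have [m m0 [K [K0 H]]] := out_slopes_local Hms (sphere0 p).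
exists m => //; exists K%:~R; first by rewrite ler0z.
move=> r /andP[r0 rm]; have [|H1 H2] := H r; first by rewrite !ltW.
split=> // q /H2[k E kK]; split; first by exists k.
by rewrite E normrM (gtr0_norm r0) ler_wpM2r ?(ltW r0) // -intr_norm ler_int.
Qed.

Lemma lap_infpt l : D (infpt l) = 0.
Proof. by have [ms [/= H ->]] := lapf (infpt l); inversion H; rewrite big_nil. Qed.

End Local.

(** * Invariance of the potential *)

Section Symmetric.
Variables (R : realType) (G : tcurve R).
Implicit Types (p q : tpoint G) (v w : tV G) (e : tE G) (l : tL G) (t r : R).
Variable iota : tpoint G -> tpoint G.
Hypothesis iotaK : involutive iota.
Hypothesis iota_iso : forall p q, pdist (iota p) (iota q) = pdist p q.

(** A point at infinity is at finite distance only from itself. If [iota p] were one, [p] would be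
    the only finite point, but a leg has a vertex and an interior point. *)
Lemma finpt_iota p : finpt p -> finpt (iota p).
Proof.
move=> fp; apply/negPn/negP => ni.
have {ni}[l El] : exists l, iota p = infpt l.
  move: ni; case: (ptP (iota p)) => [v|e t te|l t t0|l]; rewrite ?finpt_edge ?finpt_leg //.
  by exists l.
have H q : finpt q -> q = p.
  move=> fq; have [r] := pdist_finite fp fq.
  by rewrite -iota_iso El => /pdist_infpt; rewrite -El => /(inv_inj iotaK).
have := H (vpt (att l)) isT; rewrite -(H _ (finpt_leg l 1)) => /(congr1 val).
by rewrite leg_pt_val.
Qed.

Lemma iota_infpt l : exists l', iota (infpt l) = infpt l'.
Proof.
have [p] : exists p, p = iota (infpt l) by exists (iota (infpt l)).
case: (ptP p) => [v|e t te|l' t t0|l'] E.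
- by have := @finpt_iota (vpt v) isT; rewrite E iotaK.
- by have := finpt_iota (finpt_edge e t); rewrite E iotaK.
- by have := finpt_iota (finpt_leg l' t); rewrite E iotaK.
- by exists l'.
Qed.

Lemma sphere_iota p : finpt p -> exists2 m : R, 0 < m &
  forall r, 0 < r < m -> perm_eq [seq iota q | q <- sphere p r] (sphere (iota p) r).
Proof.
move=> fp; have [m m0 Hm] := sphereP fp; have [m' m'0 Hm'] := sphereP (finpt_iota fp).
exists (Num.min m m'); first by rewrite lt_min m0.
move=> r; rewrite lt_min => /and3P[r0 rm rm'].
have [u1 H1] := Hm r ltac:(by rewrite r0); have [u2 H2] := Hm' r ltac:(by rewrite r0).
apply: uniq_perm; rewrite ?(map_inj_uniq (inv_inj iotaK)) //.
move=> q; rewrite -{1}(iotaK q) (mem_map (inv_inj iotaK)).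
by apply/idP/idP => [/H1 E|/H2 E]; [apply/H2|apply/H1]; rewrite -E -[in RHS]iota_iso iotaK.
Qed.

Variables (f : tpoint G -> R) (D : tpoint G -> int).
Hypothesis lapf : forall p, laplacian_at f p (D p).
Hypothesis iotaD : forall p, D (iota p) = D p.

Definition anti p : R := f p - f (iota p).

Lemma anti_local p : finpt p -> exists2 m : R, 0 < m & exists2 K : R, 0 <= K &
  forall r, 0 < r < m -> \sum_(q <- sphere p r) (anti q - anti p) = 0 /\
  forall q, q \in sphere p r -> `|anti q - anti p| <= K * r.
Proof.
move=> fp; have [m1 m10 H1] := sphere_iota fp.
have [m2 m20 [K2 K20 H2]] := lap_sphere lapf p.
have [m3 m30 [K3 K30 H3]] := lap_sphere lapf (iota p).
exists (Num.min m1 (Num.min m2 m3)); first by rewrite !lt_min m10 m20.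
exists (K2 + K3); first by rewrite addr_ge0.
move=> r; rewrite !lt_min => /and4P[r0 r1 r2 r3].
have {}H1 := H1 r ltac:(by rewrite r0).
have [S2 B2] := H2 r ltac:(by rewrite r0).
have [S3 B3] := H3 r ltac:(by rewrite r0).
have antiE q : anti q - anti p = (f q - f p) - (f (iota q) - f (iota p)) by rewrite /anti; lra.
split.
  under eq_bigr do rewrite antiE.
  rewrite sumrB S2.
  have -> : \sum_(q <- sphere p r) (f (iota q) - f (iota p)) =
            \sum_(q <- sphere (iota p) r) (f q - f (iota p)).
    by rewrite -(perm_big _ H1) [RHS]big_map.
  by rewrite S3 iotaD subrr.
move=> q pq; rewrite antiE mulrDl; apply: (le_trans (ler_normB _ _)); apply: lerD.
  by have [_] := B2 q pq.
have [] := B3 (iota q); last by [].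
by rewrite -(perm_mem H1) map_f.
Qed.

(** At a maximum the terms [M - anti q] are nonnegative and sum to zero over the sphere. *)
Lemma anti_max p M : finpt p -> (forall q, anti q <= M) -> anti p = M ->
  exists2 m : R, 0 < m & forall r q, 0 < r < m -> q \in sphere p r -> anti q = M.
Proof.
move=> fp HM pM; have [m m0 [K _ H]] := anti_local fp.
exists m => // r q rm qp; have [H0 _] := H r rm.
apply/eqP; rewrite eq_sym -subr_eq0.
have /eqP : \sum_(q <- sphere p r) (M - anti q) = 0.
  transitivity (- \sum_(q <- sphere p r) (anti q - anti p)); last by rewrite H0 oppr0.
  rewrite -sumrN; apply: eq_bigr => q1 _; rewrite pM; lra.
rewrite big_seq_cond psumr_eq0; last by move=> q' _; rewrite subr_ge0.
by move/allP => /(_ q qp); rewrite qp.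
Qed.

(** Attaining [M] is locally constant in the parameter: [anti_max] spreads the value [M] to nearby
    points, and the linear bound of [anti_local] keeps nearby values away from [M] where it is not
    attained. *)
Lemma anti_arc g b M : arc (G := G) g b -> (forall q, anti q <= M) ->
  forall x y, 0 <= x <= b -> 0 <= y <= b -> anti (g x) = M -> anti (g y) = M.
Proof.
move=> Ha HM; apply: (loc_const_segment (A := fun x => anti (g x) = M)) => t tb.
have [m m0 Hm] := arc_local Ha tb.
have fg := arc_fin Ha t.
have [gM|gM] := eqVneq (anti (g t)) M.
  have [m' m'0 Hm'] := anti_max fg HM gM.
  exists (Num.min m m'); first by rewrite lt_min m0.
  move=> s sb; rewrite lt_min => /andP[sm sm']; split=> // _.
  have [->//|st] := eqVneq s t.
  have st0 : 0 < `|s - t| by rewrite normr_gt0 subr_eq0.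
  by apply: Hm' (Hm s sb _); rewrite st0.
have [m' m'0 [K K0 Hm']] := anti_local fg.
have M0 : 0 < `|anti (g t) - M| by rewrite normr_gt0 subr_eq0.
(* Dividing by [K + 1] instead of [K] covers [K = 0]. *)
exists (Num.min m (Num.min m' (`|anti (g t) - M| / (K + 1)))).
  by rewrite !lt_min m0 m'0 divr_gt0 //; lra.
move=> s sb; rewrite !lt_min => /and3P[sm sm' sM]; split=> [gsM|]; last by move/eqP: gM.
have [st|st] := eqVneq s t; first by rewrite -st.
have st0 : 0 < `|s - t| by rewrite normr_gt0 subr_eq0.
have [_ B] := Hm' `|s - t| ltac:(by rewrite st0).
have {B} := B _ (Hm s sb ltac:(by rewrite st0)).
move: sM; rewrite ltr_pdivlMr; last lra.
rewrite gsM [`|M - _|]distrC; nra.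
Qed.

Lemma anti_arc_max g b : arc (G := G) g b ->
  exists2 c, 0 <= c <= b & forall t, 0 <= t <= b -> anti (g t) <= anti (g c).
Proof.
move=> Ha; have b0 := arc_gt0 Ha.
have [|c] := @EVT_max R (fun t => anti (g t)) 0 b (ltW b0).
  apply: cont_segment => t tb e e0.
  have [m m0 Hm] := arc_local Ha tb.
  have [m' m'0 [K K0 Hm']] := anti_local (arc_fin Ha t).
  exists (Num.min m (Num.min m' (e / (K + 1)))).
    by rewrite !lt_min m0 m'0 divr_gt0 //; lra.
  move=> s sb; rewrite !lt_min => /and3P[sm sm' sM].
  have [->|st] := eqVneq s t; first by rewrite subrr normr0.
  have st0 : 0 < `|s - t| by rewrite normr_gt0 subr_eq0.
  have [_ B] := Hm' `|s - t| ltac:(by rewrite st0).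
  have {B} := B _ (Hm s sb ltac:(by rewrite st0)).
  move: sM; rewrite ltr_pdivlMr; last lra.
  nra.
rewrite in_itv /= => cb H; exists c => // t tb; apply: H; rewrite in_itv /=; exact: tb.
Qed.

(** * Behaviour at infinity and the maximum principle *)

Hypothesis iota_cont : gcontinuous iota.
Hypothesis fleg : forall l,
  exists2 T : R, 0 <= T & forall t, T < t -> f (leg_pt l t) = f (infpt l).

(** Basic neighbourhoods of a point at infinity. The metric alone does not tie the image of
    [infpt l] to the images of far points of [l]; continuity of [iota] does, through these sets. *)
Definition leg_end l T : set (tpoint G) :=
  [set q | q = infpt l \/ exists2 t, T < t & q = leg_pt l t].

Lemma gopen_leg_end l T : 0 <= T -> gopen (leg_end l T).
Proof.
move=> T0 p [->|[t Tt ->]]; split.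
- by move=> l' [<-]; exists T => t Tt; right; exists t.
- by move=> /(_ l).
- by move=> l' E; have := finpt_leg l t; rewrite E.
- move=> _; exists (t - T); first by rewrite subr_gt0.
  move=> q /= /pdist_ball[->|[s st E]]; first by right; exists t.
  have s0 : 0 < s by lra.
  have st' : s <= t by lra.
  have [E'|E'] := (pdist_leg l q s0 st').1 E.
  + by right; exists (t - s) => //; lra.
  + by right; exists (t + s) => //; lra.
Qed.

(** By continuity [iota] maps the far part of [l] into a neighbourhood of [iota (infpt l)] on which
    [f] is constant. *)
Lemma anti_leg l : exists2 T : R, 0 <= T & forall t, T < t -> anti (leg_pt l t) = anti (infpt l).
Proof.
have [l' El'] := iota_infpt l.
have [T T0 HT] := fleg l; have [T' T'0 HT'] := fleg l'.
have /iota_cont Ho := gopen_leg_end (l := l') T'0.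
have /Ho[/(_ l erefl)[T2 HT2] _] : (iota @^-1` leg_end l' T') (infpt l).
  by rewrite /= El'; left.
exists (Num.max T T2); first by rewrite le_max T0.
move=> t; rewrite gt_max => /andP[Tt T2t]; rewrite /anti HT // El'; congr (_ - _).
by case: (HT2 t T2t) => [->//|[t' T't' ->]]; exact: HT'.
Qed.

Lemma seq_argmax (T : eqType) (h : T -> R) (s : seq T) x0 : x0 \in s ->
  exists2 x, x \in s & forall y, y \in s -> h y <= h x.
Proof.
elim: s x0 => // a s IH x0 _; case: s IH => [|b s] IH.
  by exists a; rewrite ?mem_head // => y; rewrite inE => /eqP ->.
have [x xs Hx] := IH b (mem_head _ _).
case: (leP (h x) (h a)) => [xa|/ltW ax].
  exists a; rewrite ?mem_head // => y; rewrite inE => /orP[/eqP ->//|/Hx].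
  by move=> /le_trans; apply.
exists x; first by rewrite inE xs orbT.
by move=> y; rewrite inE => /orP[/eqP ->//|/Hx].
Qed.

(** Edges are compact, and a leg may be cut off where [anti] has become constant. Finitely many
    local maxima remain, all at finite points, where the maximum principle applies. *)
Lemma anti_attains_max : exists2 p, finpt p & forall q, anti q <= anti p.
Proof.
have /choice[ce Hce] : forall e, exists c, 0 <= c <= len e /\
    forall t, 0 <= t <= len e -> anti (edge_pt e t) <= anti (edge_pt e c).
  by move=> e; have [c cb H] := anti_arc_max (arc_edge e); exists c.
have /choice[cl Hcl] : forall l, exists c, anti (infpt l) <= anti (leg_pt l c) /\
    forall t, 0 < t -> anti (leg_pt l t) <= anti (leg_pt l c).
  move=> l; have [T T0 HT] := anti_leg l.
  have T1 : 0 < T + 1 by lra.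
  have [c cb H] := anti_arc_max (arc_leg l T1); exists c.
  have Hinf : anti (infpt l) <= anti (leg_pt l c) by rewrite -(HT (T + 1)) ?H; lra.
  split=> // t t0; case: (leP t T) => tT; last by rewrite HT.
  by apply: H; lra.
pose s := [seq vpt v | v <- enum (tV G)] ++ [seq edge_pt e (ce e) | e <- enum (tE G)] ++
          [seq leg_pt l (cl l) | l <- enum (tL G)].
have /card_gt0P[v0 _] := tV_nonempty G.
have vs v : vpt v \in s by rewrite /s mem_cat map_f ?mem_enum.
have es e : edge_pt e (ce e) \in s.
  by rewrite /s !mem_cat (map_f (fun e => edge_pt e (ce e))) ?orbT ?mem_enum.
have ls l : leg_pt l (cl l) \in s.
  by rewrite /s !mem_cat (map_f (fun l => leg_pt l (cl l))) ?orbT ?mem_enum.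
have [p ps Hp] := seq_argmax anti (vs v0).
exists p.
  move: ps; rewrite /s !mem_cat => /or3P[] /mapP[x _ ->] //.
  by rewrite finpt_edge.
  by rewrite finpt_leg.
move=> q; case: (ptP q) => [v|e t te|l t t0|l].
- exact: Hp.
- by apply: le_trans (Hp _ (es e)); apply: (Hce e).2; lra.
- by apply: le_trans (Hp _ (ls l)); apply: (Hcl l).2.
- by apply: le_trans (Hp _ (ls l)); apply: (Hcl l).1.
Qed.

(** The maximum passes along an arc to some vertex, then along walks to all vertices, and from there
    to all edges and legs. *)
Lemma anti_const : exists M, forall p, finpt p -> anti p = M.
Proof.
have [p0 fp0 Hp0] := anti_attains_max; exists (anti p0); set M := anti p0.
have HM q : anti q <= M by exact: Hp0.
have edge e x y := anti_arc (arc_edge e) HM (x := x) (y := y).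
have leg l T T0 x y := anti_arc (@arc_leg R G l T T0) HM (x := x) (y := y).
have [v0 Hv0] : exists v, anti (vpt v) = M.
  move: fp0 (erefl M); rewrite {2}/M; case: (ptP p0) => [v|e t te|l t t0|l] // _ E.
  - by exists v.
  - exists (src e); rewrite -(edge_pt_src e (lexx 0)); apply: (edge e t) => //; lra.
  - exists (att l); rewrite -(leg_pt0 l (lexx 0)); apply: (leg l t t0 t) => //; lra.
have Hst e : anti (vpt (src e)) = M <-> anti (vpt (tgt e)) = M.
  have e0 := len_gt0 e.
  rewrite -(edge_pt_src e (lexx 0)) -(edge_pt_tgt (lexx (len e))).
  by split; apply: edge; lra.
have Hv v : anti (vpt v) = M.
  have [s] := tconnected v0 v; elim: s v0 Hv0 => [|[e b] s IH] u Hu /=; first by move=> /eqP <-.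
  by move=> /andP[/eqP Eu]; apply: IH; move: Hu; rewrite -Eu; case: b {Eu} => /Hst.
move=> p; case: (ptP p) => [v|e t te|l t t0|l] // _.
- by apply: (edge e 0); rewrite ?edge_pt_src //; lra.
- by apply: (leg l t t0 0); rewrite ?leg_pt0 //; lra.
Qed.

Lemma f_iota p : finpt p -> f (iota p) = f p.
Proof.
have [M HM] := anti_const => fp.
have := HM _ (finpt_iota fp); rewrite -(HM _ fp) /anti iotaK; lra.
Qed.

End Symmetric.

(** * The fixed locus *)

(* lra raises an uncatchable error on goals that are not real (in)equalities. *)
Ltac real_lra := lazymatch goal with
  | |- is_true (_ <= _) => lra | |- is_true (_ < _) => lra
  | |- is_true (_ && _) => lra | |- @eq (Real.sort _) _ _ => lra | _ => idtac end.

Section FixedLocus.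
Variables (R : realType) (G : tcurve R).
Implicit Types (p q : tpoint G) (v w : tV G) (e : tE G) (l : tL G) (t r : R).
Variable iota : tpoint G -> tpoint G.
Hypothesis iotaK : involutive iota.
Hypothesis iota_iso : forall p q, pdist (iota p) (iota q) = pdist p q.

Lemma arc_local_pdist g b t : arc (G := G) g b -> 0 <= t <= b -> exists2 m : R, 0 < m &
  forall s, 0 <= s <= b -> 0 < `|s - t| < m -> pdist (g t) (g s) = `|s - t|%:E.
Proof.
move=> Ha tb; have [m m0 Hm] := arc_local Ha tb.
have [m' m'0 Hm'] := sphereP (arc_fin Ha t).
exists (Num.min m m'); first by rewrite lt_min m0.
move=> s sb; rewrite lt_min => /and3P[s0 sm sm'].
have [_ H] := Hm' `|s - t| ltac:(by rewrite s0 sm').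
by apply/H; apply: Hm => //; rewrite s0.
Qed.

(** * Fixed points along one arc *)

Section Arc.
Variables (g : R -> tpoint G) (b : R).
Hypothesis Ha : arc g b.

(** With its centre fixed, the two-point sphere of radius [r] about [g s] is mapped into itself. *)
Lemma fixed_two_pts s x r : 0 < s < b -> 0 < r -> r <= s -> r <= b - s ->
  iota (g s) = g s -> x = s - r \/ x = s + r ->
  iota (g x) = g (s - r) \/ iota (g x) = g (s + r).
Proof.
move=> sb r0 rs rb fs xr; apply/(arc_sphere Ha) => //.
by rewrite -{1}fs iota_iso; apply/(arc_sphere Ha) => //; case: xr => ->; auto.
Qed.

Lemma fixed_pair s r : 0 < s < b -> 0 < r -> r <= s -> r <= b - s ->
  iota (g s) = g s -> iota (g (s + r)) = g (s + r) <-> iota (g (s - r)) = g (s - r).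
Proof.
move=> sb r0 rs rb fs; have H x := @fixed_two_pts s x r sb r0 rs rb fs.
by split => E; [case: (H (s - r))|case: (H (s + r))]; auto => E'; rewrite E' -[RHS]iotaK E' E.
Qed.

(* If iota fixes g s and g (s + d), it cannot swap g (s + r) and g (s - r), since
   their distances to g (s + d) differ. *)
Lemma fixed_fill s d : 0 < s < b -> 0 < d -> d * 2 <= s -> d * 2 <= b - s ->
  iota (g s) = g s -> iota (g (s + d)) = g (s + d) ->
  forall x, `|x - s| <= s -> `|x - s| <= b - s -> iota (g x) = g x.
Proof.
move=> sb d0 ds db fs fd.
have H r : 0 < r -> r <= s -> r <= b - s -> iota (g (s + r)) = g (s + r).
  move=> r0 rs rb; have [->//|rd] := eqVneq r d.
  have [|E|//] := @fixed_two_pts s (s + r) r sb r0 rs rb fs; first by right.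
  have rd0 : 0 < `|r - d| by rewrite normr_gt0 subr_eq0.
  have sdb : 0 < s + d < b by lra.
  have rds : `|r - d| <= s + d by rewrite ler_norml; lra.
  have rdb : `|r - d| <= b - (s + d) by rewrite ler_norml; lra.
  (* The sphere of this radius about [g (s + d)] consists of [g (s + r)] and [g (s + 2d - r)]. The
     bound [d * 2 <= b - s] keeps [s + 2d - r] inside the arc, so [arc_inj] separates the second
     point from [g (s - r)]. *)
  have [|H|H] := @fixed_two_pts (s + d) (s + r) `|r - d| sdb rd0 rds rdb fd.
  - case: (leP d r) => dr; [right; rewrite ger0_norm|left; rewrite ltr0_norm]; lra.
  - move: H; case: (leP d r) => dr; [rewrite ger0_norm; last lra|rewrite ltr0_norm; last lra] => H.
      exfalso; rewrite E in H.
      by have := arc_inj Ha _ _ H => /(_ ltac:(lra) ltac:(lra)); lra.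
    by rewrite H; congr g; lra.
  - move: H; case: (leP d r) => dr; [rewrite ger0_norm; last lra|rewrite ltr0_norm; last lra] => H.
      by rewrite H; congr g; lra.
    exfalso; rewrite E in H.
    by have := arc_inj Ha _ _ H => /(_ ltac:(lra) ltac:(lra)); lra.
move=> x xs xb; case: (ltrgtP x s) => [lt|gt|->//].
  have xE : x = s - `|x - s| by rewrite ltr0_norm; lra.
  have xs0 : 0 < `|x - s| by rewrite ltr0_norm; lra.
  by rewrite xE; apply: (fixed_pair sb xs0 xs xb fs).1; exact: H.
have xE : x = s + `|x - s| by rewrite gtr0_norm; lra.
by rewrite xE; apply: H => //; rewrite gtr0_norm; lra.
Qed.

(** If [g] is fixed near [t], then [fixed_fill] fixes the largest symmetric interval about [t].
    Being fixed nearby therefore propagates from [s] to the midpoint [b / 2], whose symmetric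
    interval is the whole arc. *)
Lemma fixed_arc s d : 0 < s < b -> 0 < d -> d * 2 <= s -> d * 2 <= b - s ->
  iota (g s) = g s -> iota (g (s + d)) = g (s + d) ->
  forall x, 0 <= x <= b -> iota (g x) = g x.
Proof.
move=> sb d0 ds db fs fd.
pose A t := exists2 m : R, 0 < m & forall x, `|x - t| < m -> iota (g x) = g x.
have fillA t : 0 < t < b -> A t -> forall x, `|x - t| <= t -> `|x - t| <= b - t -> iota (g x) = g x.
  move=> tb [m m0 Hm]; pose d' := Num.min (m / 2) (Num.min (t / 2) ((b - t) / 2)).
  have [d'0 d'm d't d'b] : [/\ 0 < d', d' <= m / 2, d' <= t / 2 & d' <= (b - t) / 2].
    by rewrite /d' !ge_min !lt_min !lexx ?orbT; split=> //; lra.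
  apply: (@fixed_fill t d') => //; real_lra.
    by apply: Hm; rewrite subrr normr0.
  by apply: Hm; rewrite ger0_norm; lra.
have As : A s.
  exists (Num.min s (b - s)); first by rewrite lt_min; lra.
  by move=> x; rewrite lt_min => /andP[xs xb]; apply: (@fixed_fill s d) => //; rewrite ltW.
have Ab : A (b / 2).
  pose lo := Num.min s (b / 2); pose hi := Num.max s (b / 2).
  have lo1 : 0 < lo by rewrite lt_min; lra.
  have hi1 : hi < b by rewrite gt_max; lra.
  have sI : lo <= s <= hi by rewrite ge_min le_max lexx.
  have bI : lo <= b / 2 <= hi by rewrite ge_min le_max lexx !orbT.
  apply: (loc_const_segment (A := A) _ sI bI As) => t tI.
  (* Within this radius [t] and [x] each lie in the symmetric interval of the other. *)
  pose m := Num.min t (b - t) / 2.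
  have [m0 mt mb] : [/\ 0 < m, m * 2 <= t & m * 2 <= b - t].
    by rewrite /m -mulrA mulVf // mulr1 !ge_min !lexx orbT divr_gt0 // lt_min; lra.
  have tr x y : 0 < x < b -> `|y - x| < x -> `|y - x| < b - x -> A x -> A y.
    move=> xb yx yb Ax; exists (Num.min (x - `|y - x|) (b - x - `|y - x|)).
      by rewrite lt_min; lra.
    move=> z; rewrite lt_min => /andP[z1 z2]; have := ler_distD y z x => ztri.
    by apply: (fillA x xb Ax); lra.
  exists m => // x xI xt; have := xt; rewrite ltr_norml => /andP[x1 x2].
  by split; apply: tr; rewrite ?[`|t - x|]distrC; lra.
have b0 := arc_gt0 Ha.
by move=> x xb; apply: (fillA (b / 2) _ Ab); rewrite ?ler_norml; lra.
Qed.

Lemma fixed_interior t : 0 < t < b -> iota (g t) = g t ->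
  (forall m, 0 < m -> exists2 d, 0 < d < m & iota (g (t + d)) = g (t + d)) ->
  forall x, 0 <= x <= b -> iota (g x) = g x.
Proof.
move=> tb ft /(_ (Num.min (t / 2) ((b - t) / 2)))[|d]; first by rewrite lt_min; lra.
by rewrite lt_min => /and3P[d0 d1 d2] fd; apply: (@fixed_arc t d) => //; lra.
Qed.

(** At an end of the arc there is no two-point sphere to use. Instead [iota] fixes [g (d / 2)]: its
    only other possible image is [g (d + d / 2)], which has a different distance from the fixed
    point [g 0]. *)
Lemma fixed_start : exists2 m : R, 0 < m & forall d, 0 < d < m ->
  iota (g 0) = g 0 -> iota (g d) = g d -> forall x, 0 <= x <= b -> iota (g x) = g x.
Proof.
have b0 := arc_gt0 Ha.
have [m m0 Hm] := arc_local_pdist Ha (t := 0) ltac:(lra).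
exists (Num.min m b / 2); first by rewrite divr_gt0 // lt_min m0.
move=> d /andP[d0]; rewrite ltr_pdivlMr // lt_min => /andP[dm db] f0 fd.
have db' : 0 < d < b by lra.
have dist x : 0 < x -> x < d * 2 -> pdist (g 0) (g x) = x%:E.
  by move=> x0 xd; have := Hm x; rewrite subr0 (gtr0_norm x0); apply; lra.
have fh : iota (g (d - d / 2)) = g (d - d / 2).
  have [||||//|E] := @fixed_two_pts d (d - d / 2) (d / 2) db' _ _ _ fd; real_lra.
    by left.
  have := dist (d - d / 2) ltac:(lra) ltac:(lra).
  by rewrite -iota_iso f0 E (dist (d + d / 2)); [move=> -[?]; exfalso; lra|lra|lra].
apply: (@fixed_arc d (d / 2)) => //; real_lra.
by apply: (fixed_pair (s := d) (r := d / 2) _ _ _ _ fd).2; real_lra.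
Qed.

(** * Arcs and connected components of the fixed locus *)

Lemma arc_connected U W : gopen U -> gopen W ->
  (forall t, 0 <= t <= b -> (U (g t) \/ W (g t)) /\ ~ (U (g t) /\ W (g t))) ->
  forall x y, 0 <= x <= b -> 0 <= y <= b -> U (g x) -> U (g y).
Proof.
move=> oU oW UW.
have near (V : set (tpoint G)) t : gopen V -> 0 <= t <= b -> V (g t) -> exists2 m : R, 0 < m &
    forall s, 0 <= s <= b -> `|s - t| < m -> V (g s).
  move=> oV tb Vt; have [_ H] := oV _ Vt.
  have [|r r0 Hr] := H; first by move=> l E; have := arc_fin Ha t; rewrite E.
  have [m m0 Hm] := arc_local_pdist Ha tb; exists (Num.min m r); first by rewrite lt_min m0.
  move=> s sb; rewrite lt_min => /andP[sm sr]; have [->//|st] := eqVneq s t.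
  by apply: Hr; rewrite /= Hm // normr_gt0 subr_eq0 st.
apply: (loc_const_segment (A := fun t => U (g t))) => t tb.
have [[Ut|Wt] nUW] := UW t tb.
  have [m m0 Hm] := near _ _ oU tb Ut; exists m => // s sb st.
  by split => // _; exact: Hm.
have [m m0 Hm] := near _ _ oW tb Wt; exists m => // s sb st.
split=> [Us|Ut]; last by case: nUW.
by have [_ []] := UW s sb; split => //; exact: Hm.
Qed.

Variable C : set (tpoint G).
Hypothesis compC : component_of (real_locus iota) C.

(** The union of [C] with a fixed arc that meets it is connected, so maximality of [C] absorbs the
    arc. *)
Lemma fixed_arc_component : (forall x, 0 <= x <= b -> iota (g x) = g x) ->
  forall x y, 0 <= x <= b -> 0 <= y <= b -> C (g x) -> C (g y).
Proof.
move=> fg x y xb yb Cx; have [CF C0 cC maxC] := compC.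
pose C' := C `|` [set q | exists2 t, 0 <= t <= b & q = g t].
suff <- : C' = C by right; exists y.
apply: maxC; first by move=> q Cq; left.
  by move=> q [/CF//|[t tb ->]]; exact: fg.
move=> U W oU oW cov dis.
have cov' q : C q -> (U `|` W) q by move=> Cq; apply: cov; left.
have dis' : C `&` U `&` W = set0.
  by apply/seteqP; split=> // q [[Cq Uq] Wq]; rewrite -dis; split => //; split => //; left.
have arcUW t : 0 <= t <= b -> (U (g t) \/ W (g t)) /\ ~ (U (g t) /\ W (g t)).
  move=> tb; have C't : C' (g t) by right; exists t.
  by split; [exact: cov|case=> Ut Wt; have : set0 (g t) by rewrite -dis].
case: (cC U W oU oW cov' dis') => sub; [left|right] => q [/sub//|[t tb ->]].
  exact: (arc_connected oU oW arcUW xb tb (sub _ Cx)).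
apply: (arc_connected oW oU _ xb tb (sub _ Cx)) => z zb.
by have [? ?] := arcUW z zb; tauto.
Qed.

Lemma gopen_arc t d : 0 < t < b -> d <= t -> d <= b - t ->
  gopen [set q | exists2 s, `|s - t| < d & q = g s].
Proof.
move=> tb dt db p /= [s st ->]; split.
  by move=> l E; have := arc_fin Ha s; rewrite E.
move=> _; have := st; rewrite ltr_norml => /andP[s1 s2].
exists (Num.min (d - `|s - t|) (Num.min s (b - s))); first by rewrite !lt_min; lra.
move=> q /= /pdist_ball[->|[r]]; first by exists s.
rewrite !lt_min => /and4P[r0 rd rs rb] /(arc_sphere Ha)[||||->|->]; real_lra.
  exists (s - r) => //; have := ler_distD s (s - r) t.
  by rewrite (_ : s - r - s = - r) ?normrN ?(gtr0_norm r0); lra.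
exists (s + r) => //; have := ler_distD s (s + r) t.
by rewrite (_ : s + r - s = r) ?(gtr0_norm r0); lra.
Qed.

Lemma gopen_neq p : finpt p -> gopen [set q | q <> p].
Proof.
move=> fp q /= qp; split.
  move=> l _; case: (ptP p) => [v|e t te|l' t t0|l']; last 2 first.
  - by exists t => s ts /(congr1 val); rewrite !leg_pt_val //; [case|]; lra.
  - by exists 0 => s s0 E; have := finpt_leg l s; rewrite E.
  - by exists 0 => s s0 /(congr1 val); rewrite leg_pt_val.
  - by exists 0 => s s0 /(congr1 val); rewrite leg_pt_val // edge_pt_val.
move=> qinf; have fq : finpt q.
  move: qinf; case: (ptP q) => [v|e t te|l' t t0|l'] //; rewrite ?finpt_edge ?finpt_leg //.
  by move=> /(_ l').
have [r Er] := pdist_finite fq fp.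
have r0 : 0 < r.
  rewrite ltNge; apply/negP => r0; have /pdist_ball[E|[s /andP[s0 _]]] : (pdist q p < 1%:E)%E.
  - by rewrite Er lte_fin; lra.
  - exact: qp.
  - by rewrite Er => -[]; lra.
by exists r => // z /= zr E; move: zr; rewrite E Er ltxx.
Qed.

(** No fixed point lies just to the right of [t], hence by [fixed_pair] none just to the left. A
    small open arc and the complement of [g t] then separate [g t] from the rest of [C]. *)
Lemma isolated_component t m : 0 < t < b -> C (g t) -> 0 < m ->
  (forall d, 0 < d < m -> iota (g (t + d)) <> g (t + d)) -> C = [set g t].
Proof.
move=> tb Ct m0 Hm; have [CF C0 cC maxC] := compC.
have ft : iota (g t) = g t by exact: CF.
pose d := Num.min m (Num.min t (b - t)).
have [d0 dm dt db] : [/\ 0 < d, d <= m, d <= t & d <= b - t].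
  by rewrite /d !ge_min !lexx ?orbT !lt_min m0; split=> //; lra.
pose U := [set q | exists2 s, `|s - t| < d & q = g s].
have oU : gopen U by exact: gopen_arc.
have oW := gopen_neq (arc_fin Ha t).
have FU q : iota q = q -> U q -> q = g t.
  move=> fq [s st E]; rewrite E in fq *; case: (ltrgtP s t) => [lt|gt|->//].
    move: st; rewrite ltr0_norm; last lra.
    move=> st; exfalso; apply: (Hm (t - s)); first lra.
    apply: (fixed_pair (r := t - s) tb _ _ _ ft).2; real_lra.
    by rewrite (_ : t - (t - s) = s) //; lra.
  move: st; rewrite gtr0_norm; last lra.
  move=> st; exfalso; apply: (Hm (s - t)); first lra.
  by rewrite (_ : t + (s - t) = s) //; lra.
have Ut : U (g t) by exists t => //; rewrite subrr normr0.
apply/seteqP; split=> [q Cq|q -> //].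
case: (cC U _ oU oW) => [z Cz||sub|sub].
- by case: (pselect (z = g t)) => [->|nz]; [left|right].
- by apply/seteqP; split=> // z [[Cz Uz]] /=; apply; apply: FU => //; exact: CF.
- by apply: FU; [exact: CF|exact: sub].
- by have := sub _ Ct.
Qed.

End Arc.
End FixedLocus.

(** * Slopes and parity *)

Section Germs.
Variable R : realType.
Implicit Types (g h : R -> R) (b t : R) (k : int).

(** Convertible with [out_slope f gamma k] when [h] is the composite of [f] with [gamma]. *)
Definition germ h k : Prop :=
  exists2 m : R, 0 < m & forall s, 0 <= s <= m -> h s = h 0 + k%:~R * s.

Lemma germ_uniq h k k' : germ h k -> germ h k' -> k = k'.
Proof.
move=> [m m0 Hm] [m' m'0 Hm']; pose s := Num.min m m'.
have [s0 sm sm'] : [/\ 0 < s, s <= m & s <= m'] by rewrite lt_min !ge_min !lexx orbT m0.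
have := Hm s; rewrite (Hm' s); last by rewrite ltW.
rewrite sm ltW // => /(_ isT) /addrI /(mulIf (lt0r_neq0 s0)) /eqP.
by rewrite eqr_int => /eqP.
Qed.

Lemma germ_right h b b' k c : b < b' ->
  (forall t, b <= t <= b' -> h t = k%:~R * t + c) -> germ (fun s => h (b + s)) k.
Proof.
move=> bb' H; exists (b' - b); first by rewrite subr_gt0.
by move=> s sb; rewrite addr0 (H (b + s)) ?(H b); [ring|lra|lra].
Qed.

Lemma germ_left h b b' k c : b' < b ->
  (forall t, b' <= t <= b -> h t = k%:~R * t + c) -> germ (fun s => h (b - s)) (- k).
Proof.
move=> bb' H; exists (b - b'); first by rewrite subr_gt0.
by move=> s sb; rewrite subr0 (H (b - s)) ?(H b); [rewrite rmorphN; ring|lra|lra].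
Qed.

(* k0 and k1 are the slopes of g pointing into the segment at its two ends. *)
Lemma pw_affine_seg_sum g b (d : R -> int) : 0 < b -> pw_affine_seg g b ->
  (forall t, 0 < t < b -> exists k k', [/\ germ (fun s => g (t + s)) k,
     germ (fun s => g (t - s)) k' & d t = k + k']) ->
  exists (s : seq R) (k0 k1 : int),
    [/\ uniq s /\ (forall t, t \in s -> 0 < t < b),
        forall t, 0 < t < b -> t \notin s -> d t = 0,
        \sum_(t <- s) d t = - (k0 + k1),
        germ g k0 & germ (fun s => g (b - s)) k1].
Proof.
move=> b0 [[|n] [a [m [c [a0 an amono aff]]]]] Hd; first by rewrite -an a0 ltxx in b0.
have homo i j : (i < j)%N -> (j <= n.+1)%N -> a i < a j.
  elim: j => // j IH; rewrite ltnS leq_eqVlt => /predU1P[->|ij] jn; first exact: amono.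
  by apply: lt_trans (amono j jn); exact: IH ij (ltnW jn).
have homoW i j : (i <= j)%N -> (j <= n.+1)%N -> a i <= a j.
  by rewrite leq_eqVlt => /predU1P[->//|ij] jn; exact/ltW/homo.
have right i : (i <= n)%N -> germ (fun s => g (a i + s)) (m i).
  by move=> ilt; apply: (germ_right (amono i ilt)) => t; exact: aff.
have left i : (i <= n)%N -> germ (fun s => g (a i.+1 - s)) (- m i).
  by move=> ilt; apply: (germ_left (amono i ilt)) => t; exact: aff.
have dE t k k' : 0 < t < b -> germ (fun s => g (t + s)) k ->
    germ (fun s => g (t - s)) k' -> d t = k + k'.
  move=> tb Hk Hk'; have [l [l' [Hl Hl' ->]]] := Hd t tb.
  by rewrite (germ_uniq Hl Hk) (germ_uniq Hl' Hk').
have locate t : forall j, (j <= n.+1)%N -> a 0 <= t < a j ->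
    exists2 i, (i < j)%N & a i <= t < a i.+1.
  elim=> [|j IH] jn /andP[t0 tj]; first by move: (le_lt_trans t0 tj); rewrite ltxx.
  case: (ltP t (a j)) => tj'; last by exists j => //; rewrite tj'.
  by have [|i ij Hi] := IH (ltnW jn); [rewrite t0|exists i => //; exact: leqW].
(* There are [n.+1] pieces, so the interior breakpoints are [a 1] to [a n], and the slope pointing
   inwards at the far end is [- m n]. *)
exists [seq a i.+1 | i <- index_iota 0 n], (m 0), (- m n); split.
- split.
    rewrite map_inj_in_uniq ?iota_uniq // => i j; rewrite !mem_index_iota /= => ilt jlt E.
    case: (ltngtP i j) => // lt; exfalso.
      by have := homo i.+1 j.+1 lt (ltnW jlt); rewrite E ltxx.
    by have := homo j.+1 i.+1 lt (ltnW ilt); rewrite E ltxx.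
  move=> t /mapP[i]; rewrite mem_index_iota /= => ilt ->.
  by rewrite -an -a0 (homo 0 i.+1) ?(homo i.+1 n.+1) // ltnW.
- move=> t tb tn; have [|i ilt /andP[it ti]] := locate t n.+1 (leqnn _); rewrite ?a0 ?an.
    by case/andP: tb => /ltW -> ->.
  have {}it : a i < t.
    rewrite lt_neqAle it andbT; apply/eqP => E; case: i ilt E {it ti} => [|i] ilt E.
      by rewrite -E a0 ltxx in tb.
    by case/mapP: tn; exists i => //; rewrite mem_index_iota.
  have R1 : germ (fun s => g (t + s)) (m i).
    apply: (germ_right (c := c i) ti) => x /andP[x1 x2].
    by apply: aff => //; rewrite x2 (le_trans _ x1) // ltW.
  have R2 : germ (fun s => g (t - s)) (- m i).
    apply: (germ_left (c := c i) it) => x /andP[x1 x2].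
    by apply: aff => //; rewrite x1 (le_trans x2) // ltW.
  by rewrite (dE t _ _ tb R1 R2) subrr.
(* At [a i.+1] the outgoing slopes are [m i.+1] and [- m i], so the sum telescopes to
   [m n - m 0]. *)
- rewrite big_map opprB -(telescope_sumr m) //.
  apply: eq_big_nat => i /andP[_ ilt]; apply: dE; [|exact: right|exact: left (ltnW ilt)].
  by rewrite -an -a0 (homo 0 i.+1) ?(homo i.+1 n.+1) // ltnW.
- have := right 0 isT; rewrite a0 => -[eps eps0 H]; exists eps => // s sb.
  by have := H s sb; rewrite !add0r.
- by have := left n (leqnn n); rewrite an.
Qed.

(** One extra constant piece of length 1 is appended, so that the statement on segments applies with
    slope zero at the far end. *)
Lemma pw_affine_leg_seg g y : pw_affine_leg g y -> exists2 T : R, 0 <= T &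
  (forall t, T <= t -> g t = y) /\ pw_affine_seg g (T + 1).
Proof.
move=> [n [a [m [c [a0 amono aff last]]]]].
have ltn_leq_cases i : (i <= n)%N -> i = n \/ (i < n)%N by rewrite leq_eqVlt => /predU1P.
have an i : (i <= n)%N -> 0 <= a i.
  elim: i => [|i IH] ilt; first by rewrite a0.
  exact: le_trans (IH (ltnW ilt)) (ltW (amono i ilt)).
exists (a n); first exact: an.
split => //; exists n.+1, (fun i => if (i <= n)%N then a i else a n + 1),
  (fun i => if (i < n)%N then m i else 0), (fun i => if (i < n)%N then c i else y).
split=> //=; first by rewrite ltnn.
  move=> i; rewrite ltnS => /ltn_leq_cases[->|ilt]; first by rewrite leqnn ltnn ltrDl.
  by rewrite ilt (ltnW ilt) amono.
move=> i t; rewrite ltnS => /ltn_leq_cases[->|ilt].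
  by rewrite leqnn ltnn => /andP[nt _]; rewrite last // mul0r add0r.
by rewrite ilt (ltnW ilt); exact: aff.
Qed.

End Germs.

(** Without fixed points the involution pairs [x] with [sigma x]; the induction removes one such
    pair at a time. *)
Lemma invol_sum_even (T : eqType) (sigma : T -> T) (k : T -> int) (s : seq T) :
  involutive sigma -> uniq s -> (forall x, x \in s -> sigma x \in s) ->
  (forall x, x \in s -> sigma x != x) -> (forall x, x \in s -> k (sigma x) = k x) ->
  exists z, \sum_(x <- s) k x = z + z.
Proof.
move=> sK; have [n] := ubnP (size s); elim: n s => // n IH [|x s] szs us cl nf ks.
  by exists 0; rewrite big_nil addr0.
have xsx : sigma x \in s.
  by have := cl x (mem_head _ _); rewrite inE (negbTE (nf x (mem_head _ _))).
have {}us := us; case/andP: us => xns us.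
have sub y : y \in rem (sigma x) s -> y \in s by exact: mem_rem.
have [||y ys|y ys|y ys|z Hz] := IH (rem (sigma x) s).
- by rewrite size_rem //; case: (s) xsx szs => //= ? ? _ /ltnW.
- exact: rem_uniq.
- have ys' := sub y ys; rewrite mem_rem_uniq // inE /= in ys.
  case/andP: ys => ysx _; rewrite mem_rem_uniq // inE /= (inj_eq (inv_inj sK)).
  have := cl y; rewrite !inE ys' orbT => /(_ isT) /predU1P[E|->].
    by rewrite -E sK eqxx in ysx.
  by rewrite andbT; apply: contraNneq xns => <-.
- by apply: nf; rewrite inE sub ?orbT.
- by apply: ks; rewrite inE sub ?orbT.
exists (k x + z); rewrite big_cons (perm_big _ (perm_to_rem xsx)) big_cons Hz ks ?mem_head //.
by rewrite [RHS]addrACA [LHS]addrA.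
Qed.

Section Parity.
Variables (R : realType) (G : tcurve R).
Implicit Types (p q : tpoint G) (v w : tV G) (e : tE G) (l : tL G) (t r : R).
Variable iota : tpoint G -> tpoint G.
Hypothesis iotaK : involutive iota.
Hypothesis iota_iso : forall p q, pdist (iota p) (iota q) = pdist p q.
Variables (f : tpoint G -> R) (D : tpoint G -> int).
Hypothesis lapf : forall p, laplacian_at f p (D p).
Hypothesis f_iota : forall p, finpt p -> f (iota p) = f p.

(** The floor only extracts the integer from a difference quotient that is integral for small [r];
    elsewhere its value is meaningless. *)
Definition slope p r q : int := Num.floor ((f q - f p) / r).

Lemma slopeE p r q k : 0 < r -> f q - f p = k%:~R * r -> slope p r q = k.
Proof. by move=> r0 E; rewrite /slope E mulfK ?gt_eqF // intrKfloor. Qed.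

Lemma sphere_finpt p r : finpt p -> 0 < r -> forall q, q \in sphere p r -> finpt q.
Proof.
case: (ptP p) => [v|e t te|l t t0|l] // _ r0 q.
- by rewrite sphere_vpt !mem_cat => /or3P[] /mapP[x _ ->]; rewrite ?finpt_edge ?finpt_leg.
- by rewrite /sphere /dirs edge_pt_val //= !inE => /orP[]/eqP ->; rewrite finpt_edge.
- by rewrite /sphere /dirs leg_pt_val //= !inE => /orP[]/eqP ->; rewrite finpt_leg.
Qed.

(** The moved points of a small sphere are exchanged in pairs by [iota] with equal slopes, which
    accounts for [z + z]. *)
Lemma laplacian_fixed p : finpt p -> iota p = p -> exists2 m : R, 0 < m &
  forall r, 0 < r < m -> exists z,
    D p = \sum_(q <- sphere p r | iota q == q) slope p r q + (z + z).
Proof.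
move=> fp ip; have [m m0 Hm] := sphereP fp; have [m' m'0 [K _ Hm']] := lap_sphere lapf p.
exists (Num.min m m'); first by rewrite lt_min m0.
move=> r; rewrite lt_min => /and3P[r0 rm rm'].
have [us Hs] := Hm r ltac:(by rewrite r0); have [Sum Hk] := Hm' r ltac:(by rewrite r0).
have slopes q : q \in sphere p r -> f q - f p = (slope p r q)%:~R * r.
  by move=> /Hk[[k E] _]; rewrite {1}E (slopeE r0 E).
have DE : D p = \sum_(q <- sphere p r) slope p r q.
  apply/eqP; rewrite -(eqr_int R) rmorph_sum /=; apply/eqP.
  apply: (mulIf (lt0r_neq0 r0)); rewrite -Sum mulr_suml.
  by apply: eq_big_seq => q /slopes.
have := @invol_sum_even _ iota (slope p r) [seq q <- sphere p r | iota q != q] iotaK.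
case=> [|q|q|q|z Hz].
- exact: filter_uniq.
- rewrite !mem_filter iotaK eq_sym => /andP[-> /Hs E] /=.
  by apply/Hs; rewrite -E -{1}ip iota_iso.
- by rewrite mem_filter => /andP[].
- by rewrite mem_filter => /andP[_ /(sphere_finpt fp r0) fq]; rewrite /slope f_iota.
exists z; rewrite -Hz big_filter DE.
by rewrite (bigID (fun q => iota q == q)).
Qed.

End Parity.

(** * Degree of a component *)

Lemma finite_uniform (R : realType) (I : finType) (P : I -> R -> Prop) :
  (forall i, exists2 m : R, 0 < m & forall r, 0 < r < m -> P i r) ->
  exists2 m : R, 0 < m & forall i r, 0 < r < m -> P i r.
Proof.
move=> H; have /choice[m Hm] : forall i, exists m : R, 0 < m /\ forall r, 0 < r < m -> P i r.
  by move=> i; have [m m0 Hm] := H i; exists m.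
exists (\big[Num.min/1]_i m i).
  by apply/bigmin_gtP; split=> // i _; exact: (Hm i).1.
move=> i r /andP[r0 rm]; apply: (Hm i).2; rewrite r0 (lt_le_trans rm) //.
exact: bigmin_le_cond.
Qed.

Section Degree.
Variables (R : realType) (G : tcurve R).
Implicit Types (p q : tpoint G) (v w : tV G) (e : tE G) (l : tL G) (t r : R).

Lemma deg_on_seq (D : tpoint G -> int) (C : set (tpoint G)) (s : seq (tpoint G)) :
  uniq s -> (forall p, D p != 0 -> p \in s) ->
  deg_on D C = \sum_(p <- s | `[< C p >]) D p.
Proof.
move=> us Ds; rewrite /deg_on (fsbigE [seq p <- s | `[< C p >]]).
- rewrite big_filter_cond; apply: eq_bigl => p.
  by case: asboolP => //= Cp; apply/mem_set.
- exact: filter_uniq.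
- by move=> p; rewrite /= mem_filter => /andP[/asboolP].
- move=> p Cp; rewrite mem_filter negb_and => /orP[|pns].
    by move/asboolPn.
  by apply/eqP; apply: contraNT pns; exact: Ds.
Qed.

Lemma deg_onB (D1 D2 : tpoint G -> int) (C : set (tpoint G)) :
  is_divisor D1 -> is_divisor D2 ->
  deg_on (fun p => D2 p - D1 p) C = deg_on D2 C - deg_on D1 C.
Proof.
move=> /finite_seqP[s1 H1] /finite_seqP[s2 H2].
have D1s p : D1 p != 0 -> p \in s1 by move=> Dp; have : [set p | D1 p != 0] p by []; rewrite H1.
have D2s p : D2 p != 0 -> p \in s2 by move=> Dp; have : [set p | D2 p != 0] p by []; rewrite H2.
rewrite !(@deg_on_seq _ _ (undup (s1 ++ s2))) ?undup_uniq //.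
- by rewrite sumrB.
- by move=> p /D1s; rewrite mem_undup mem_cat => ->.
- by move=> p /D2s; rewrite mem_undup mem_cat orbC => ->.
- move=> p; rewrite mem_undup mem_cat; case: (eqVneq (D1 p) 0) => [->|/D1s -> //].
  by rewrite subr0 orbC => /D2s ->.
Qed.

Variable iota : tpoint G -> tpoint G.
Hypothesis iotaK : involutive iota.
Hypothesis iota_iso : forall p q, pdist (iota p) (iota q) = pdist p q.
Variables (f : tpoint G -> R) (D : tpoint G -> int).
Hypothesis lapf : forall p, laplacian_at f p (D p).
Hypothesis f_iota : forall p, finpt p -> f (iota p) = f p.
Hypothesis ratf : rational_fun f.

Lemma lap_two_dirs p g h : dirs p = [:: g; h] -> exists k k',
  [/\ germ (fun s => f (g s)) k, germ (fun s => f (h s)) k' & D p = k + k'].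
Proof.
move=> dp; have [ms []] := lapf p; rewrite dp => H ->.
inversion H as [|? k ? ms' Hk H']; subst.
inversion H' as [|? k' ? ms'' Hk' H'']; subst; inversion H''; subst.
by exists k, k'; rewrite !big_cons big_nil addr0.
Qed.

Lemma lap_edge e t : 0 < t < len e -> exists k k',
  [/\ germ (fun s => f (edge_pt e (t + s))) k, germ (fun s => f (edge_pt e (t - s))) k'
    & D (edge_pt e t) = k + k'].
Proof. by move=> te; apply: lap_two_dirs; rewrite /dirs edge_pt_val. Qed.

Lemma lap_leg l t : 0 < t -> exists k k',
  [/\ germ (fun s => f (leg_pt l (t + s))) k, germ (fun s => f (leg_pt l (t - s))) k'
    & D (leg_pt l t) = k + k'].
Proof. by move=> t0; apply: lap_two_dirs; rewrite /dirs leg_pt_val. Qed.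

(** Packed into one tuple so that [choice] can select, for all edges at once, the parameters that
    carry [D] and the two inward slopes. *)
Lemma edge_data e : exists x : seq R * int * int,
  [/\ uniq x.1.1 /\ (forall t, t \in x.1.1 -> 0 < t < len e),
      forall t, 0 < t < len e -> t \notin x.1.1 -> D (edge_pt e t) = 0,
      \sum_(t <- x.1.1) D (edge_pt e t) = - (x.1.2 + x.2),
      germ (fun s => f (edge_pt e s)) x.1.2 & germ (fun s => f (edge_pt e (len e - s))) x.2].
Proof.
have [s [k0 [k1 H]]] := pw_affine_seg_sum (len_gt0 e) (ratf.1 e) (@lap_edge e).
by exists (s, k0, k1).
Qed.

Lemma leg_data l : exists x : seq R * int,
  [/\ uniq x.1 /\ (forall t, t \in x.1 -> 0 < t),
      forall t, 0 < t -> t \notin x.1 -> D (leg_pt l t) = 0,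
      \sum_(t <- x.1) D (leg_pt l t) = - x.2 &
      germ (fun s => f (leg_pt l s)) x.2].
Proof.
have [T T0 [HT seg]] := pw_affine_leg_seg (ratf.2 l).
have T1 : 0 < T + 1 by lra.
have lapT t : 0 < t < T + 1 -> _ := fun tT => lap_leg l (t := t) ltac:(lra).
have [s [k0 [k1 [[us sT] Ds sumD germ0 germ1]]]] := pw_affine_seg_sum T1 seg lapT.
have far t : T < t ->
    germ (fun s => f (leg_pt l (t + s))) 0 /\ germ (fun s => f (leg_pt l (t - s))) 0.
  move=> Tt; split; exists (t - T); rewrite ?subr_gt0 // => x xt; rewrite !HT ?mul0r ?addr0 //; lra.
(* Since [f] is constant far out, only the slope at the attaching vertex survives. *)
have k10 : k1 = 0 by apply: germ_uniq germ1 (far (T + 1) ltac:(lra)).2.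
exists (s, k0); split=> //=.
- by split=> // t /sT /andP[].
- move=> t t0 ts; case: (ltP t (T + 1)) => tT; first by apply: Ds; rewrite ?t0.
  have [k [k' [Hk Hk' ->]]] := lap_leg l t0.
  have [|H0 H0'] := far t; first lra.
  by rewrite (germ_uniq Hk H0) (germ_uniq Hk' H0').
- by rewrite sumD k10 addr0.
Qed.

Variable C : set (tpoint G).
Hypothesis compC : component_of (real_locus iota) C.

Let C_fixed p : C p -> iota p = p.
Proof. by case: compC => CF _ _ _ /CF. Qed.

(** Here [C] is one point, and neither point of a small sphere about it is fixed, so the sum of
    [laplacian_fixed] is empty. *)
Lemma deg_isolated g b t m : arc (G := G) g b -> 0 < t < b -> C (g t) -> 0 < m ->
  (forall d, 0 < d < m -> iota (g (t + d)) <> g (t + d)) ->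
  exists z, deg_on D C = z + z.
Proof.
move=> Ha tb Ct m0 Hm; have ft := C_fixed Ct.
rewrite (isolated_component iotaK iota_iso Ha compC tb Ct m0 Hm) /deg_on fsbig_set1.
have fg := arc_fin Ha t.
have [m1 m10 H1] := laplacian_fixed iotaK iota_iso lapf f_iota fg ft.
have [m2 m20 H2] := sphereP fg.
pose r := Num.min m (Num.min (Num.min t (b - t)) (Num.min m1 m2)) / 2.
have M0 : 0 < r by rewrite divr_gt0 // !lt_min m0 m10 m20; lra.
have : r * 2 <= Num.min m (Num.min (Num.min t (b - t)) (Num.min m1 m2)) by rewrite /r mulfVK.
rewrite !le_min => /and4P[rm /andP[rt rb] r1 r2].
have [|z ->] := H1 r; first lra.
have [|_ Hs] := H2 r; first lra.
exists z; rewrite big_seq_cond big1 ?add0r // => q /andP[/Hs /(arc_sphere Ha)].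
move=> /(_ ltac:(lra) ltac:(lra) ltac:(lra) ltac:(lra)) qE /eqP fq; exfalso.
apply: (Hm r); first lra.
case: qE fq => -> // E.
by apply: (fixed_pair iotaK iota_iso Ha tb _ _ _ ft).2 E; lra.
Qed.

(** * Components made of vertices and whole edges and legs *)

Section NoIsolated.
Hypothesis nonisolated : forall g b t, arc (G := G) g b -> 0 < t < b -> C (g t) ->
  forall m, 0 < m -> exists2 d, 0 < d < m & iota (g (t + d)) = g (t + d).

Lemma arc_in_component g b t : arc (G := G) g b -> 0 < t < b -> C (g t) ->
  forall x, 0 <= x <= b -> C (g x).
Proof.
move=> Ha tb Ct x xb; apply: (fixed_arc_component Ha compC _ _ xb Ct); last lra.
by apply: (fixed_interior iotaK iota_iso Ha tb); [exact: C_fixed|exact: (nonisolated Ha tb Ct)].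
Qed.

(** Replaces the test whether a direction is fixed by the test whether its edge lies in [C], which
    depends neither on the radius nor on the end. Any interior parameter [c] may serve as the test
    point. *)
Lemma germ_in_component g b : arc (G := G) g b -> C (g 0) ->
  exists2 m : R, 0 < m & forall d, 0 < d < m -> forall c, 0 < c < b ->
    (iota (g d) == g d) = `[< C (g c) >].
Proof.
move=> Ha C0; have b0 := arc_gt0 Ha; have [m m0 Hm] := fixed_start iotaK iota_iso Ha.
exists (Num.min m b); first by rewrite lt_min m0.
move=> d; rewrite lt_min => /and3P[d0 dm db] c cb; apply/eqP/asboolP.
  move=> fd; apply: (fixed_arc_component Ha compC _ _ _ C0); [|lra|lra].
  by apply: Hm fd; [rewrite d0|exact: C_fixed].
by move=> Cc; apply: C_fixed; apply: (arc_in_component Ha cb Cc); lra.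
Qed.

Lemma deg_even : exists z, deg_on D C = z + z.
Proof.
have /choice[ed Hed] := edge_data; have /choice[ld Hld] := leg_data.
(* Membership of an edge or leg is tested at one interior point; the choice is immaterial by
   [arc_in_component]. *)
pose eC e := `[< C (edge_pt e (len e / 2)) >]; pose lC l := `[< C (leg_pt l 1) >].
have mid e : 0 < len e / 2 < len e by have := len_gt0 e; lra.
have eCE e t : 0 < t < len e -> `[< C (edge_pt e t) >] = eC e.
  move=> te; have m := mid e; apply/asboolP/asboolP => Ce.
    by apply: (arc_in_component (arc_edge e) te Ce); lra.
  by apply: (arc_in_component (arc_edge e) m Ce); lra.
have lCE l t : 0 < t -> `[< C (leg_pt l t) >] = lC l.
  move=> t0; have T0 : 0 < t + 2 by lra.
  apply/asboolP/asboolP => Ce; apply: (arc_in_component (arc_leg l T0) _ Ce); lra.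
have eCsrc e : eC e -> `[< C (vpt (src e)) >].
  move=> /asboolP Ce; apply/asboolP; rewrite -(edge_pt_src e (lexx 0)).
  by have m := mid e; apply: (arc_in_component (arc_edge e) m Ce); lra.
have eCtgt e : eC e -> `[< C (vpt (tgt e)) >].
  move=> /asboolP Ce; apply/asboolP; rewrite -(edge_pt_tgt (lexx (len e))).
  by have m := mid e; apply: (arc_in_component (arc_edge e) m Ce); lra.
have lCatt l : lC l -> `[< C (vpt (att l)) >].
  move=> /asboolP Ce; apply/asboolP; rewrite -(leg_pt0 l (lexx 0)).
  have T0 : 0 < 2 :> R by lra.
  by apply: (arc_in_component (arc_leg l T0) _ Ce); lra.
(* Modulo 2 only the fixed directions at [v] count, and these are the ends at [v] of edges and legs
   in [C]. A loop contributes once in each of the first two sums. *)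
have Dv v : `[< C (vpt v) >] -> exists z, D (vpt v) =
    \sum_(e | eC e && (src e == v)) (ed e).1.2 + \sum_(e | eC e && (tgt e == v)) (ed e).2 +
    \sum_(l | lC l && (att l == v)) (ld l).2 + (z + z).
  move=> /asboolP Cv.
  have [m0 m00 H0] := laplacian_fixed iotaK iota_iso lapf f_iota (p := vpt v) isT (C_fixed Cv).
  have [m1 m10 H1] : exists2 m : R, 0 < m & forall e r, 0 < r < m -> src e = v ->
      (iota (edge_pt e r) == edge_pt e r) = eC e /\ slope f (vpt v) r (edge_pt e r) = (ed e).1.2.
    apply: finite_uniform => e; have [se|se] := eqVneq (src e) v; last first.
      by exists 1 => // r _ E; rewrite E eqxx in se.
    have [|m mm Hm] := germ_in_component (arc_edge e); first by rewrite edge_pt_src // se.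
    have [_ _ _ [m' m'0 Hm'] _] := Hed e.
    exists (Num.min m m'); first by rewrite lt_min mm.
    move=> r; rewrite lt_min => /and3P[r0 rm rm'] _; split; first by apply: Hm => //; rewrite r0.
    apply: slopeE => //; rewrite Hm'; last by rewrite !ltW.
    by rewrite edge_pt_src // se addrC addKr.
  have [m2 m20 H2] : exists2 m : R, 0 < m & forall e r, 0 < r < m -> tgt e = v ->
      (iota (edge_pt e (len e - r)) == edge_pt e (len e - r)) = eC e /\
      slope f (vpt v) r (edge_pt e (len e - r)) = (ed e).2.
    apply: finite_uniform => e; have [se|se] := eqVneq (tgt e) v; last first.
      by exists 1 => // r _ E; rewrite E eqxx in se.
    have [|m mm Hm] := germ_in_component (arc_rev (arc_edge e)).
      by rewrite subr0 edge_pt_tgt // se.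
    have [_ _ _ _ [m' m'0 Hm']] := Hed e.
    exists (Num.min m m'); first by rewrite lt_min mm.
    move=> r; rewrite lt_min => /and3P[r0 rm rm'] _; split.
      by rewrite (Hm r _ (len e / 2)) ?r0 // eCE //; have := mid e; lra.
    apply: slopeE => //; rewrite Hm'; last by rewrite !ltW.
    by rewrite subr0 edge_pt_tgt // se addrC addKr.
  have [m3 m30 H3] : exists2 m : R, 0 < m & forall l r, 0 < r < m -> att l = v ->
      (iota (leg_pt l r) == leg_pt l r) = lC l /\ slope f (vpt v) r (leg_pt l r) = (ld l).2.
    apply: finite_uniform => l; have [se|se] := eqVneq (att l) v; last first.
      by exists 1 => // r _ E; rewrite E eqxx in se.
    have T0 : 0 < 2 :> R by lra.
    have [|m mm Hm] := germ_in_component (arc_leg l T0); first by rewrite leg_pt0 // se.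
    have [_ _ _ [m' m'0 Hm']] := Hld l.
    exists (Num.min m m'); first by rewrite lt_min mm.
    move=> r; rewrite lt_min => /and3P[r0 rm rm'] _; split.
      by apply: Hm => //; rewrite ?r0 //; lra.
    apply: slopeE => //; rewrite Hm'; last by rewrite !ltW.
    by rewrite leg_pt0 // se addrC addKr.
  pose r := Num.min (Num.min m0 m1) (Num.min m2 m3) / 2.
  have r0 : 0 < r by rewrite divr_gt0 // !lt_min m00 m10 m20.
  have : r * 2 <= Num.min (Num.min m0 m1) (Num.min m2 m3) by rewrite /r mulfVK.
  rewrite !le_min => /andP[/andP[rm0 rm1] /andP[rm2 rm3]].
  have [|z ->] := H0 r; first lra.
  exists z; congr (_ + _); rewrite sphere_vpt !big_cat /= addrA.
  congr (_ + _ + _); rewrite big_map big_filter_cond big_enum_cond /=.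
  - apply: eq_big => [e|e /andP[/eqP se _]]; last by apply: (H1 e r _ se).2; lra.
    by case: eqP => [se|_]; rewrite ?andbF // andbT; apply: (H1 e r _ se).1; lra.
  - apply: eq_big => [e|e /andP[/eqP se _]]; last by apply: (H2 e r _ se).2; lra.
    by case: eqP => [se|_]; rewrite ?andbF // andbT; apply: (H2 e r _ se).1; lra.
  - apply: eq_big => [e|e /andP[/eqP se _]]; last by apply: (H3 e r _ se).2; lra.
    by case: eqP => [se|_]; rewrite ?andbF // andbT; apply: (H3 e r _ se).1; lra.
have /choice[zv Hzv] : forall v, exists z, `[< C (vpt v) >] -> D (vpt v) =
    \sum_(e | eC e && (src e == v)) (ed e).1.2 + \sum_(e | eC e && (tgt e == v)) (ed e).2 +
    \sum_(l | lC l && (att l == v)) (ld l).2 + (z + z).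
  move=> v; case: (boolP `[< C (vpt v) >]) => Cv; last by exists 0.
  by have [z Hz] := Dv v Cv; exists z.
have ed_in e t : t \in (ed e).1.1 -> 0 < t < len e.
  by have [[_ H] _ _ _ _] := Hed e; exact: H.
have ld_in l t : t \in (ld l).1 -> 0 < t.
  by have [[_ H] _ _ _] := Hld l; exact: H.
(* A duplicate-free list containing the support of [D]; points at infinity are omitted because [D]
   vanishes there. *)
pose S := [seq vpt v | v <- enum (tV G)] ++
  [seq edge_pt e t | e <- enum (tE G), t <- (ed e).1.1] ++
  [seq leg_pt l t | l <- enum (tL G), t <- (ld l).1].
have uS : uniq S.
  rewrite /S !cat_uniq; apply/and3P; split; last (apply/and3P; split).
  - by rewrite map_inj_uniq ?enum_uniq // => v w /(congr1 val)[].
  - apply/hasPn => p; rewrite mem_cat => /orP[] /allpairsPdep[x [t [_ tx ->]]];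
      apply/mapP => -[v _] /(congr1 val).
      by rewrite edge_pt_val //; exact: (ed_in x t tx).
    by rewrite leg_pt_val //; exact: (ld_in x t tx).
  - apply: allpairs_uniq_dep; [exact: enum_uniq|by move=> e _; have [[]] := Hed e|].
    move=> _ _ /allpairsPdep[e [t [_ te ->]]] /allpairsPdep[e' [t' [_ te' ->]]] /= /(congr1 val).
    by rewrite !edge_pt_val ?(ed_in _ _ te) ?(ed_in _ _ te') // => -[-> ->].
  - apply/hasPn => p /allpairsPdep[l [t [_ tl ->]]]; apply/allpairsPdep => -[e [t' [_ te']]].
    by move=> /(congr1 val); rewrite leg_pt_val ?edge_pt_val ?(ld_in _ _ tl) ?(ed_in _ _ te').
  - apply: allpairs_uniq_dep; [exact: enum_uniq|by move=> e _; have [[]] := Hld e|].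
    move=> _ _ /allpairsPdep[e [t [_ te ->]]] /allpairsPdep[e' [t' [_ te' ->]]] /= /(congr1 val).
    by rewrite !leg_pt_val ?(ld_in _ _ te) ?(ld_in _ _ te') // => -[-> ->].
have DS p : D p != 0 -> p \in S.
  rewrite /S !mem_cat; case: (ptP p) => [v|e t te|l t t0|l] Dp.
  - by rewrite map_f ?mem_enum.
  - apply/orP; right; apply/orP; left; apply/allpairsPdep; exists e, t.
    split; rewrite ?mem_enum //; apply: contraNT Dp => tn.
    by have [_ H _ _ _] := Hed e; rewrite H.
  - apply/orP; right; apply/orP; right; apply/allpairsPdep; exists l, t.
    split; rewrite ?mem_enum //; apply: contraNT Dp => tn.
    by have [_ H _ _] := Hld l; rewrite H.
  - by rewrite (lap_infpt lapf) in Dp.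
rewrite (deg_on_seq C uS DS) big_mkcond /S !big_cat /= big_map !big_allpairs_dep.
rewrite !big_enum -big_mkcond /=.
exists (\sum_(v | `[< C (vpt v) >]) zv v).
have -> : \sum_e \sum_(t <- (ed e).1.1) (if `[< C (edge_pt e t) >] then D (edge_pt e t) else 0) =
    - (\sum_(e | eC e) (ed e).1.2 + \sum_(e | eC e) (ed e).2).
  rewrite -big_split -sumrN [RHS]big_mkcond; apply: eq_bigr => e _ /=.
  have [_ _ <- _ _] := Hed e; rewrite -big_mkcond big_seq_cond; case: ifP => Ce.
    rewrite [RHS]big_seq; apply: eq_bigl => t.
    by case tin: (t \in _) => //=; rewrite eCE ?ed_in.
  by apply: big1 => t /andP[tin]; rewrite eCE ?ed_in // Ce.
have -> : \sum_l \sum_(t <- (ld l).1) (if `[< C (leg_pt l t) >] then D (leg_pt l t) else 0) =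
    - \sum_(l | lC l) (ld l).2.
  rewrite -sumrN [RHS]big_mkcond; apply: eq_bigr => l _ /=.
  have [_ _ <- _] := Hld l; rewrite -big_mkcond big_seq_cond; case: ifP => Cl.
    rewrite [RHS]big_seq; apply: eq_bigl => t.
    by case tin: (t \in _) => //=; rewrite lCE ?(ld_in l t tin).
  by apply: big1 => t /andP[tin]; rewrite lCE ?(ld_in l t tin) // Cl.
rewrite (eq_bigr _ (fun v => Hzv v)) !big_split /=.
(* Regroups the end slopes from vertices to edges and legs. Every end of an edge or leg in [C] is a
   vertex of [C], so all of them occur and cancel the interior sums. *)
rewrite -!partition_big //.
ring.
Qed.
End NoIsolated.
End Degree.

Theorem theorem4 (R : realType) (G : tcurve R) (iota : tpoint G -> tpoint G)
    (D1 D2 : tpoint G -> int) (C : set (tpoint G)) :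
  real_structure iota ->
  is_divisor D1 -> is_divisor D2 ->
  real_divisor iota D1 -> real_divisor iota D2 ->
  lin_equiv D1 D2 ->
  component_of (real_locus iota) C ->
  (deg_on D1 C = deg_on D2 C %[mod 2])%Z.
Proof.
move=> [iotaK iota_iso iota_cont] div1 div2 real1 real2 [f [ratf lapf]] compC.
have iotaD p : D2 (iota p) - D1 (iota p) = D2 p - D1 p by rewrite real1 real2.
have fleg l : exists2 T : R, 0 <= T & forall t, T < t -> f (leg_pt l t) = f (infpt l).
  have [T T0 [fT _]] := pw_affine_leg_seg (ratf.2 l).
  by exists T => // t /ltW; exact: fT.
have fi := f_iota iotaK iota_iso lapf iotaD iota_cont fleg.
have [z degE] : exists z, deg_on (fun p => D2 p - D1 p) C = z + z.
  (* Either [C] contains an interior point of an arc with no fixed points just to its right, or the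
     negation provides the hypothesis [nonisolated]. *)
  case: (pselect (exists g b t m, [/\ arc (G := G) g b, 0 < t < b, C (g t), 0 < m &
      forall d, 0 < d < m -> iota (g (t + d)) <> g (t + d)])) => [|nonisol].
    move=> [g [b [t [m [Ha tb Ct m0 Hm]]]]].
    exact: (deg_isolated iotaK iota_iso lapf fi compC Ha tb Ct m0 Hm).
  apply: (deg_even iotaK iota_iso lapf fi ratf compC) => g b t Ha tb Ct m m0.
  apply: contrapT => nfix; apply: nonisol; exists g, b, t, m; split=> // d dm fd.
  by apply: nfix; exists d.
have -> : deg_on D2 C = z * 2 + deg_on D1 C.
  by apply/eqP; rewrite -subr_eq -(deg_onB C div1 div2) degE mulrDr mulr1.
by rewrite modzMDl.
Qed.
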